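(* Let $\mathbb{F}$ be an algebraically closed field of characteristic different from $2$, and let $D(T_2)$ be the Hopf algebra with generators $g,G,x,X$ presented in the context. Suppose $D(T_2)$ acts on $M_m(\mathbb{F})$, with inner action given by $u$ chosen as in the context, so that $u(g)$ does not commute with $u(G)$ and $u(x)$ is nilpotent. Then $m=2k$ with $k=2r$ for some $r$, and the action is isomorphic to precisely one inner action with $$u(g)=I_k\otimes A,\quad u(G)=I_k\otimes B,\quad u(x)=\begin{pmatrix}0&I_r\\0&0\end{pmatrix}\otimes C,\quad u(X)=\begin{pmatrix}0&\tau I_r\\-I_r&0\end{pmatrix}\otimes C,$$ for some $\tau\in\mathbb{F}$, where $$A=\begin{pmatrix}1&0\\0&-1\end{pmatrix},\quad B=\begin{pmatrix}0&1\\1&0\end{pmatrix},\quad C=\begin{pmatrix}0&1\\-1&0\end{pmatrix}.$$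
   Context: The Hopf algebra $D(T_2)$ (Drinfeld double of the $4$-dimensional Taft algebra) is presented by generators $g,G,x,X$ and relations $g^2=G^2=1$, $x^2=X^2=0$, $gG=Gg$, $gx=-xg$, $Gx=-xG$, $gX=-Xg$, $GX=-XG$, $xX+Xx=1-gG$, with $g,G$ group-like, $\Delta(x)=x\otimes1+g\otimes x$, $\Delta(X)=X\otimes1+G\otimes X$. An action of $H$ on an algebra $R$ is an $H$-module algebra structure; two actions $*,\circ$ on $R$ are isomorphic if there is an algebra automorphism $\varphi$ of $R$ with $h\circ\varphi(a)=\varphi(h*a)$ for all $h,a$. An action is inner, via a convolution invertible linear map $u:H\to R$ with $u(1)=1_R$, if $h*a=\sum u(h_{(1)})au^{-1}(h_{(2)})$; here this means $h*a=u(h)au(h)^{-1}$ for group-like $h$, $x*a=u(x)a-u(g)au(g)^{-1}u(x)$, $X*a=u(X)a-u(G)au(G)^{-1}u(X)$. Every action of $D(T_2)$ on $M_m(\mathbb{F})$ is inner, and $u$ is chosen so that $u(g)u(x)=-u(x)u(g)$, $u(G)u(x)=-u(x)u(G)$, $u(g)u(X)=-u(X)u(g)$, $u(G)u(X)=-u(X)u(G)$. *)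

(* Defs.v *)
From HB Require Import structures.
From mathcomp Require Import all_boot all_order all_algebra.
From mathcomp Require Import ring.
From mathcomp.real_closed Require Import mxtens.

Set Implicit Arguments.
Unset Strict Implicit.
Unset Printing Implicit Defensive.

Import GRing.Theory.
Local Open Scope ring_scope.

Definition DT2_relations (F : fieldType) (S : algType F) (g G x X : S) : Prop :=
  [/\ [/\ g * g = 1, G * G = 1, x * x = 0 & X * X = 0],
      [/\ g * G = G * g, g * x = - (x * g) & G * x = - (x * G)],
      [/\ g * X = - (X * g) & G * X = - (X * G)] &
      x * X + X * x = 1 - g * G].

(* The vector space with basis I.                                             *)
Record fmod (I : finType) (F : fieldType) := FMod {fmod_val : {ffun I -> F}}.

HB.instance Definition _ I F := [isNew for @fmod_val I F].
HB.instance Definition _ I F := [Choice of fmod I F by <:].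

Section FMod.
Variables (I : finType) (F : fieldType).
Implicit Types (h k : fmod I F) (i j : I).

Definition mkfmod (f : I -> F) : fmod I F := FMod [ffun i => f i].
Definition coord h i : F := fmod_val h i.
Arguments coord : simpl never.

Lemma coordE f i : coord (mkfmod f) i = f i.
Proof. by rewrite /coord ffunE. Qed.

Lemma fmodP h k : (forall i, coord h i = coord k i) -> h = k.
Proof. by move=> hk; apply/val_inj/ffunP. Qed.

Definition fmod_add h k := mkfmod (fun i => coord h i + coord k i).
Definition fmod_opp h := mkfmod (fun i => - coord h i).
Definition fmod_zero := mkfmod (fun=> 0).
Definition fmod_scale (a : F) h := mkfmod (fun i => a * coord h i).

Fact fmod_addA : associative fmod_add.
Proof. by move=> h k l; apply/fmodP => i; rewrite !coordE addrA. Qed.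
Fact fmod_addC : commutative fmod_add.
Proof. by move=> h k; apply/fmodP => i; rewrite !coordE addrC. Qed.
Fact fmod_add0 : left_id fmod_zero fmod_add.
Proof. by move=> h; apply/fmodP => i; rewrite !coordE add0r. Qed.
Fact fmod_addN : left_inverse fmod_zero fmod_opp fmod_add.
Proof. by move=> h; apply/fmodP => i; rewrite !coordE addNr. Qed.

HB.instance Definition _ :=
  GRing.isZmodule.Build (fmod I F) fmod_addA fmod_addC fmod_add0 fmod_addN.

Fact fmod_scaleA a b h : fmod_scale a (fmod_scale b h) = fmod_scale (a * b) h.
Proof. by apply/fmodP => i; rewrite !coordE mulrA. Qed.
Fact fmod_scale1 : left_id 1 fmod_scale.
Proof. by move=> h; apply/fmodP => i; rewrite !coordE mul1r. Qed.
Fact fmod_scaleDr : right_distributive fmod_scale +%R.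
Proof. by move=> a h k; apply/fmodP => i; rewrite !coordE mulrDr. Qed.
Fact fmod_scaleDl h : {morph fmod_scale^~ h : a b / a + b}.
Proof. by move=> a b; apply/fmodP => i; rewrite !coordE mulrDl. Qed.

HB.instance Definition _ := GRing.Zmodule_isLmodule.Build F (fmod I F)
  fmod_scaleA fmod_scale1 fmod_scaleDr fmod_scaleDl.

Lemma coord0 i : coord 0 i = 0. Proof. exact: coordE. Qed.
Lemma coordD h k i : coord (h + k) i = coord h i + coord k i.
Proof. exact: coordE. Qed.
Lemma coordN h i : coord (- h) i = - coord h i. Proof. exact: coordE. Qed.
Lemma coordZ a h i : coord (a *: h) i = a * coord h i.
Proof. exact: coordE. Qed.

Definition fmod_coordE := (coordE, coord0, coordD, coordN, coordZ).

Definition fbase i : fmod I F := mkfmod (fun j => (i == j)%:R).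

Lemma coord_sum J (r : seq J) (P : pred J) (f : J -> fmod I F) i :
  coord (\sum_(j <- r | P j) f j) i = \sum_(j <- r | P j) coord (f j) i.
Proof. by elim/big_rec2: _ => [|j s t _ <-]; rewrite fmod_coordE. Qed.

Lemma fmod_sum h : h = \sum_i coord h i *: fbase i.
Proof.
apply/fmodP => j; rewrite coord_sum (bigD1 j) //= big1 => [|i ij].
  by rewrite addr0 !fmod_coordE eqxx mulr1.
by rewrite !fmod_coordE (negbTE ij) mulr0.
Qed.

Lemma fbase_sum (V : lmodType F) (f : I -> V) i :
  \sum_j coord (fbase i) j *: f j = f i.
Proof.
rewrite (bigD1 i) //= big1 => [|j ij]; first by rewrite coordE eqxx scale1r addr0.
by rewrite coordE eq_sym (negbTE ij) scale0r.
Qed.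

Lemma fmod_elim (P : fmod I F -> Prop) :
  P 0 -> (forall a h k, P h -> P k -> P (a *: h + k)) ->
  (forall i, P (fbase i)) -> forall h, P h.
Proof.
move=> P0 PD Pb h; rewrite [h]fmod_sum; elim/big_rec: _ => // i k _ Pk.
exact: PD.
Qed.

End FMod.

(* (a, b, c, d) stands for the monomial g^a G^b x^c X^d; D(T_2) has the 16    *)
(* monomials as a basis.                                                      *)
Definition monom := (bool * bool * bool * bool)%type.

Definition DT2 (F : fieldType) : Type := fmod monom F.

HB.instance Definition _ (F : fieldType) :=
  GRing.Lmodule.copy (DT2 F) (fmod monom F).

Section Algebra.
Variable F : fieldType.
Implicit Types (h k l : DT2 F) (p q : monom).

Definition mon p : DT2 F := fbase F p.
Definition msign p : F := let: (a, b, _, _) := p in (-1) ^+ (a + b)%N.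

(* Left multiplications by g, G, x, X in the monomial basis.  Moving x or X   *)
(* across g^a G^b gives (-1)^(a+b), and X x = 1 - gG - x X.                   *)
Definition Lg h : DT2 F := mkfmod (fun '(a, b, c, d) => coord h (~~ a, b, c, d)).
Definition LG h : DT2 F := mkfmod (fun '(a, b, c, d) => coord h (a, ~~ b, c, d)).
Definition Lx h : DT2 F := mkfmod (fun p => let: (a, b, c, d) := p in
  if c then msign p * coord h (a, b, false, d) else 0).
Definition LX h : DT2 F := mkfmod (fun p => let: (a, b, c, d) := p in
  msign p *
  (if c then if d then - coord h (a, b, true, false) else 0
   else (if d then coord h (a, b, false, false) else 0)
        + (coord h (a, b, true, d) - coord h (~~ a, ~~ b, true, d)))).

Fact Lg_lin : linear Lg.
Proof. by move=> t h k; apply/fmodP=> -[[[a b] c] d]; do 2!rewrite ?fmod_coordE /=. Qed.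
Fact LG_lin : linear LG.
Proof. by move=> t h k; apply/fmodP=> -[[[a b] c] d]; do 2!rewrite ?fmod_coordE /=. Qed.
Fact Lx_lin : linear Lx.
Proof.
move=> t h k; apply/fmodP=> -[[[a b] c] d]; do 2!rewrite ?fmod_coordE /=.
case: c; ring.
Qed.
Fact LX_lin : linear LX.
Proof.
move=> t h k; apply/fmodP=> -[[[a b] c] d]; do 2!rewrite ?fmod_coordE /=.
case: c; case: d; ring.
Qed.

HB.instance Definition _ := GRing.isLinear.Build F (DT2 F) (DT2 F) *:%R Lg Lg_lin.
HB.instance Definition _ := GRing.isLinear.Build F (DT2 F) (DT2 F) *:%R LG LG_lin.
HB.instance Definition _ := GRing.isLinear.Build F (DT2 F) (DT2 F) *:%R Lx Lx_lin.
HB.instance Definition _ := GRing.isLinear.Build F (DT2 F) (DT2 F) *:%R LX LX_lin.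

Definition op_relations (V : lmodType F) (g G x X : V -> V) : Prop :=
  [/\ [/\ forall v, g (g v) = v, forall v, G (G v) = v,
          forall v, x (x v) = 0 & forall v, X (X v) = 0],
      [/\ forall v, G (g v) = g (G v), forall v, x (g v) = - g (x v) &
          forall v, x (G v) = - G (x v)],
      [/\ forall v, X (g v) = - g (X v) & forall v, X (G v) = - G (X v)] &
      forall v, X (x v) = v - g (G v) - x (X v)].

Lemma L_relations : op_relations Lg LG Lx LX.
Proof.
by split; [split|split|split|] => v; apply/fmodP => -[[[a b] c] d];
  do 2!rewrite ?fmod_coordE /=; case: a; case: b; case: c; case: d;
  do 2!rewrite /= ?fmod_coordE; rewrite ?fmod_coordE /=; ring.
Qed.

Lemma Lg_mon a b c d : Lg (mon (a, b, c, d)) = mon (~~ a, b, c, d).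
Proof.
by apply/fmodP=> -[[[a' b'] c'] d']; do 2!rewrite ?fmod_coordE /=;
  case: a; case: b; case: c; case: d; case: a'; case: b'; case: c'; case: d'.
Qed.

Lemma LG_mon a b c d : LG (mon (a, b, c, d)) = mon (a, ~~ b, c, d).
Proof.
by apply/fmodP=> -[[[a' b'] c'] d']; do 2!rewrite ?fmod_coordE /=;
  case: a; case: b; case: c; case: d; case: a'; case: b'; case: c'; case: d'.
Qed.

Lemma Lx_mon a b c d : Lx (mon (a, b, c, d)) =
  (-1) ^+ (a + b)%N *: (if c then 0 else mon (a, b, true, d)).
Proof.
apply/fmodP=> -[[[a' b'] c'] d']; do 2!rewrite ?fmod_coordE /=.
by case: a; case: b; case: c; case: d; case: a'; case: b'; case: c'; case: d';
  rewrite ?fmod_coordE /=; ring.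
Qed.

Lemma LX_mon a b c d : LX (mon (a, b, c, d)) =
  (-1) ^+ (a + b)%N *:
  (if c then mon (a, b, false, d) - mon (~~ a, ~~ b, false, d)
             - (if d then 0 else mon (a, b, true, true))
   else if d then 0 else mon (a, b, false, true)).
Proof.
apply/fmodP=> -[[[a' b'] c'] d']; do 2!rewrite ?fmod_coordE /=.
by case: a; case: b; case: c; case: d; case: a'; case: b'; case: c'; case: d';
  rewrite ?fmod_coordE /=; ring.
Qed.

(* opeval h v is the action of h on v in the module with operators g' .. X'.  *)
Section Eval.
Variables (V : lmodType F) (g' G' x' X' : {linear V -> V}).
Hypothesis rel : op_relations g' G' x' X'.

Definition opmon p (v : V) : V := let: (a, b, c, d) := p in
  iter a g' (iter b G' (iter c x' (iter d X' v))).

Fact opmon_lin p : linear (opmon p).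
Proof.
case: p => [[[a b] c] d] t v w.
by case: a; case: b; case: c; case: d; rewrite /= ?linearP.
Qed.

Definition opeval h v : V := \sum_p coord h p *: opmon p v.

Fact opevalP h t v w : opeval h (t *: v + w) = t *: opeval h v + opeval h w.
Proof.
rewrite /opeval scaler_sumr -big_split; apply: eq_bigr => p _.
by rewrite opmon_lin scalerDr !scalerA mulrC.
Qed.

Fact opevalPl v : linear (opeval^~ v).
Proof.
move=> t h k; rewrite /opeval scaler_sumr -big_split; apply: eq_bigr => p _ /=.
by rewrite !fmod_coordE scalerDl scalerA.
Qed.

Lemma opeval_mon p v : opeval (mon p) v = opmon p v.
Proof. exact: (fbase_sum (fun p => opmon p v)). Qed.

Lemma opeval_ind (L : {linear DT2 F -> DT2 F}) (f : {linear V -> V}) h v :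
  (forall p, opeval (L (mon p)) v = f (opmon p v)) -> opeval (L h) v = f (opeval h v).
Proof.
move=> Lf; elim/fmod_elim: h => [|t h k IHh IHk|p].
- by rewrite !linear0 /opeval big1 ?linear0 // => p _; rewrite coord0 scale0r.
- by rewrite linearP !opevalPl linearP IHh IHk.
- by rewrite Lf opeval_mon.
Qed.

Lemma opeval_Lg h v : opeval (Lg h) v = g' (opeval h v).
Proof.
case: rel => -[gg _ _ _] _ _ _; apply: opeval_ind => -[[[a b] c] d].
by rewrite /= Lg_mon opeval_mon; case: a; rewrite /= ?gg.
Qed.

Lemma opeval_LG h v : opeval (LG h) v = G' (opeval h v).
Proof.
case: rel => -[_ GG _ _] [Gg _ _] _ _; apply: opeval_ind => -[[[a b] c] d].
by rewrite /= LG_mon opeval_mon; case: a; case: b; rewrite /= ?(Gg, GG).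
Qed.

Lemma op_sign (f : {linear V -> V}) (a b : bool) v :
  (forall v, f (g' v) = - g' (f v)) -> (forall v, f (G' v) = - G' (f v)) ->
  f (iter a g' (iter b G' v)) =
    (-1) ^+ (a + b)%N *: iter a g' (iter b G' (f v)).
Proof.
move=> fg fG; rewrite exprD -scalerA.
by case: a; case: b; rewrite /= ?expr1 ?expr0 ?scaleN1r ?scale1r
  ?fg ?fG ?linearN ?fG ?opprK.
Qed.

Lemma opeval0 v : opeval 0 v = 0.
Proof. by rewrite /opeval big1 // => p _; rewrite coord0 scale0r. Qed.
Lemma opevalZ t k v : opeval (t *: k) v = t *: opeval k v.
Proof. by rewrite -[t *: k]addr0 opevalPl opeval0 addr0. Qed.
Lemma opevalD k l v : opeval (k + l) v = opeval k v + opeval l v.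
Proof. by rewrite -[k in k + _]scale1r opevalPl scale1r. Qed.
Lemma opevalN k v : opeval (- k) v = - opeval k v.
Proof. by rewrite -[- k]scaleN1r opevalZ scaleN1r. Qed.

Lemma opeval_Lx h v : opeval (Lx h) v = x' (opeval h v).
Proof.
case: rel => -[_ _ xx _] [_ xg xG] _ _; apply: opeval_ind => -[[[a b] c] d].
rewrite /= Lx_mon opevalZ op_sign //; congr (_ *: _).
case: c; rewrite ?opeval0 ?opeval_mon //= xx.
by case: a; case: b; rewrite /= ?linear0.
Qed.

Lemma opeval_LX h v : opeval (LX h) v = X' (opeval h v).
Proof.
case: rel => -[gg GG xx XX] [Gg xg xG] [Xg XG] Xx.
apply: opeval_ind => -[[[a b] c] d].
rewrite /= LX_mon opevalZ op_sign //; congr (_ *: _).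
by case: c; case: d; rewrite ?(opevalD, opevalN, opeval0, opeval_mon) /=
  ?Xx ?XX ?linear0 ?subr0 ?oppr0 ?addr0; case: a; case: b;
  rewrite /= ?linearB /= ?linearB /= ?linear0 ?subr0 ?(Gg, gg, GG).
Qed.

End Eval.

(* A monomial acts by successive left multiplications; DT2_universal below    *)
(* shows that this is the algebra with the given presentation.                *)
Definition DT2_mul h k : DT2 F := opeval Lg LG Lx LX h k.
Definition DT2_one : DT2 F := mon (false, false, false, false).

Fact DT2_mulDl : left_distributive DT2_mul +%R.
Proof. by move=> h k l; apply: opevalD. Qed.

Fact DT2_mulPr h : linear (DT2_mul h).
Proof. by move=> t k l; apply: opevalP. Qed.

Fact DT2_mulDr : right_distributive DT2_mul +%R.
Proof.
by move=> h k l; have := DT2_mulPr h 1 k l; rewrite !scale1r.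
Qed.

Fact DT2_mulZl t h k : t *: DT2_mul h k = DT2_mul (t *: h) k.
Proof. by rewrite /DT2_mul opevalZ. Qed.

Fact DT2_mulZr t h k : t *: DT2_mul h k = DT2_mul h (t *: k).
Proof.
have h0 : DT2_mul h 0 = 0.
  by apply: (addIr (DT2_mul h 0)); rewrite -DT2_mulDr addr0 add0r.
by rewrite -[t *: k]addr0 DT2_mulPr h0 addr0.
Qed.

Fact DT2_mul1l : left_id DT2_one DT2_mul.
Proof. by move=> h; rewrite /DT2_mul opeval_mon. Qed.

Fact DT2_mulr1 : right_id DT2_one DT2_mul.
Proof.
move=> h; elim/fmod_elim: h => [|t h k IHh IHk|[[[a b] c] d]].
- exact: opeval0.
- by rewrite /DT2_mul opevalPl -!/(DT2_mul _ _) IHh IHk.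
rewrite [LHS]opeval_mon /DT2_one.
by case: a; case: b; case: c; case: d;
  rewrite /= ?LX_mon /= ?scale1r ?Lx_mon /= ?scale1r ?LG_mon /= ?Lg_mon.
Qed.

Section Compat.
Variables (V : lmodType F) (g' G' x' X' : {linear V -> V}).
Hypothesis rel : op_relations g' G' x' X'.

Lemma opeval_mul h k v :
  opeval g' G' x' X' (DT2_mul h k) v =
  opeval g' G' x' X' h (opeval g' G' x' X' k v).
Proof.
elim/fmod_elim: h => [|t h l IHh IHl|[[[a b] c] d]].
- by rewrite [DT2_mul _ _]opeval0 !opeval0.
- by rewrite [DT2_mul _ _]opevalPl !opevalPl IHh IHl.
rewrite [DT2_mul _ _]opeval_mon opeval_mon.
by case: a; case: b; case: c; case: d;
  rewrite /= ?(opeval_Lg rel) ?(opeval_LG rel) ?(opeval_Lx rel) ?(opeval_LX rel).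
Qed.

End Compat.

Fact DT2_mulA : associative DT2_mul.
Proof. by move=> h k l; rewrite [RHS]opeval_mul //; apply: L_relations. Qed.

Fact DT2_one_neq0 : DT2_one != 0.
Proof.
apply/eqP => /(congr1 (fun h => coord h (false, false, false, false))).
by rewrite coordE coord0 eqxx => /eqP; rewrite oner_eq0.
Qed.

End Algebra.

HB.instance Definition _ (F : fieldType) := GRing.Zmodule_isNzRing.Build (DT2 F)
  (@DT2_mulA F) (@DT2_mul1l F) (@DT2_mulr1 F) (@DT2_mulDl F) (@DT2_mulDr F)
  (DT2_one_neq0 F).

HB.instance Definition _ (F : fieldType) :=
  GRing.Lmodule_isLalgebra.Build F (DT2 F) (@DT2_mulZl F).

HB.instance Definition _ (F : fieldType) :=
  GRing.Lalgebra_isAlgebra.Build F (DT2 F) (@DT2_mulZr F).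

Section Presentation.
Variable F : fieldType.
Implicit Types (h k : DT2 F) (p : monom).

Definition gD : DT2 F := mon F (true, false, false, false).
Definition GD : DT2 F := mon F (false, true, false, false).
Definition xD : DT2 F := mon F (false, false, true, false).
Definition XD : DT2 F := mon F (false, false, false, true).

Lemma gDM h : gD * h = Lg h. Proof. exact: opeval_mon. Qed.
Lemma GDM h : GD * h = LG h. Proof. exact: opeval_mon. Qed.
Lemma xDM h : xD * h = Lx h. Proof. exact: opeval_mon. Qed.
Lemma XDM h : XD * h = LX h. Proof. exact: opeval_mon. Qed.

Lemma monE a b c d :
  mon F (a, b, c, d) = gD ^+ a * GD ^+ b * xD ^+ c * XD ^+ d.
Proof.
rewrite -[LHS]mulr1 [LHS]opeval_mon -!mulrA.
case: a; case: b; case: c; case: d;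
  by rewrite /= ?expr1 ?expr0 ?mul1r ?(gDM, GDM, xDM, XDM) -?XDM ?mulr1.
Qed.

Theorem DT2_relationsP : DT2_relations gD GD xD XD.
Proof.
split; [split|split|split|];
  rewrite ?(gDM, GDM, xDM, XDM) ?(Lg_mon, LG_mon, Lx_mon, LX_mon)
    ?(addn0, add0n) ?expr0 ?expr1 ?scale1r ?scaler0 ?scaleN1r ?opprK //=.
by rewrite addrC subrK.
Qed.

Definition DT2_lift (S : algType F) (g' G' x' X' : S) h : S :=
  \sum_p coord h p *:
    (let: (a, b, c, d) := p in g' ^+ a * G' ^+ b * x' ^+ c * X' ^+ d).

Fact DT2_lift_is_linear (S : algType F) (g' G' x' X' : S) :
  linear (DT2_lift g' G' x' X').
Proof.
move=> t h k; rewrite /DT2_lift scaler_sumr -big_split.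
by apply: eq_bigr => p _ /=; rewrite !fmod_coordE scalerDl scalerA.
Qed.

HB.instance Definition _ (S : algType F) (g' G' x' X' : S) :=
  GRing.isLinear.Build F (DT2 F) S *:%R
  (DT2_lift g' G' x' X') (@DT2_lift_is_linear S g' G' x' X').

Lemma DT2_lift_mon (S : algType F) (g' G' x' X' : S) a b c d :
  DT2_lift g' G' x' X' (mon F (a, b, c, d)) =
  g' ^+ a * G' ^+ b * x' ^+ c * X' ^+ d.
Proof. exact: (fbase_sum _ (a, b, c, d)). Qed.

Section Lift.
Variables (S : algType F) (g' G' x' X' : S).
Hypothesis rel : DT2_relations g' G' x' X'.
Local Notation phi := (DT2_lift g' G' x' X').
Local Notation ev :=
  (opeval (g' \*o idfun) (G' \*o idfun) (x' \*o idfun) (X' \*o idfun)).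

Lemma mull_relations : op_relations
  (g' \*o idfun) (G' \*o idfun) (x' \*o idfun) (X' \*o idfun).
Proof.
case: rel => -[gg GG xx XX] [gG gx Gx] [gX GX] xX.
have Xx : X' * x' = 1 - g' * G' - x' * X' by rewrite -xX addrC addKr.
have anti (y z : S) : y * z = - (z * y) -> forall v, z * (y * v) = - (y * (z * v)).
  by move=> yz v; rewrite !mulrA yz mulNr opprK.
split; [split|split|split|] => v /=.
- by rewrite mulrA gg mul1r.
- by rewrite mulrA GG mul1r.
- by rewrite mulrA xx mul0r.
- by rewrite mulrA XX mul0r.
- by rewrite !mulrA gG.
- exact: anti.
- exact: anti.
- exact: anti.
- exact: anti.
by rewrite mulrA Xx !mulrBl mul1r !mulrA.
Qed.

Lemma DT2_liftE h (s : S) : ev h s = phi h * s.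
Proof.
rewrite /opeval /DT2_lift mulr_suml; apply: eq_bigr => -[[[a b] c] d] _.
rewrite -scalerAl -!mulrA.
by case: a; case: b; case: c; case: d; rewrite /= ?expr0 ?expr1 ?mul1r.
Qed.

Lemma DT2_liftM h k : phi (h * k) = phi h * phi k.
Proof.
rewrite -[LHS]mulr1 -DT2_liftE [h * k]/(DT2_mul h k).
by rewrite (opeval_mul mull_relations) !DT2_liftE mulr1.
Qed.

Lemma DT2_lift1 : phi 1 = 1.
Proof. by rewrite DT2_lift_mon !expr0 !mulr1. Qed.

(* D(T_2) is the algebra presented by g, G, x, X and its defining relations.  *)
Theorem DT2_universal :
  [/\ linear phi, monoid_morphism phi,
      [/\ phi gD = g', phi GD = G', phi xD = x' & phi XD = X'] &
      forall f : DT2 F -> S, linear f -> monoid_morphism f ->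
        [/\ f gD = g', f GD = G', f xD = x' & f XD = X'] -> f =1 phi].
Proof.
split; [exact: DT2_lift_is_linear | by split; [exact: DT2_lift1|exact: DT2_liftM] | |].
  by split; rewrite DT2_lift_mon !expr0 expr1 ?mulr1 ?mul1r.
move=> f flin [f1 fM] [fg fG fx fX] h.
pose fL := GRing.isLinear.Build F (DT2 F) S *:%R f flin.
pose ff : {linear DT2 F -> S} := HB.pack f fL.
elim/fmod_elim: h => [|t h k IHh IHk|[[[a b] c] d]].
- by rewrite linear0; exact: (linear0 ff).
- by rewrite flin linearP IHh IHk.
rewrite -/(mon F _) DT2_lift_mon monE !fM.
have fX' y (n : bool) : f (y ^+ n) = f y ^+ n by case: n; rewrite ?expr0 ?expr1.
by rewrite !fX' fg fG fx fX.
Qed.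

End Lift.
End Presentation.

(* The algebra D(T_2) (x) D(T_2), in coordinates on the mon p (x) mon q.      *)
Definition DT2x2 (F : fieldType) : Type := fmod (monom * monom)%type F.

HB.instance Definition _ (F : fieldType) :=
  GRing.Lmodule.copy (DT2x2 F) (fmod (monom * monom)%type F).

Section Tensor.
Variable F : fieldType.
Implicit Types (h k : DT2 F) (r s t : DT2x2 F) (p q : (monom * monom)%type).
Local Notation mon := (mon F).

Definition tens h k : DT2x2 F := mkfmod (fun p => coord h p.1 * coord k p.2).

Definition tens_mul s t : DT2x2 F := \sum_p \sum_q
  (coord s p * coord t q) *: tens (mon p.1 * mon q.1) (mon p.2 * mon q.2).

Definition tens_one : DT2x2 F := tens 1 1.

Fact tens_linl k : linear (tens^~ k).
Proof. by move=> a h l; apply/fmodP => p; rewrite !fmod_coordE mulrDl mulrA. Qed.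
Fact tens_linr h : linear (tens h).
Proof.
by move=> a k l; apply/fmodP => p; rewrite !fmod_coordE mulrDr mulrCA.
Qed.

Lemma tens0l k : tens 0 k = 0.
Proof. by apply/fmodP => p; rewrite !fmod_coordE mul0r. Qed.
Lemma tens0r h : tens h 0 = 0.
Proof. by apply/fmodP => p; rewrite !fmod_coordE mulr0. Qed.

Lemma fbase_tens p : fbase F p = tens (mon p.1) (mon p.2).
Proof.
apply/fmodP => -[q1 q2]; case: p => p1 p2.
by rewrite !coordE /= xpair_eqE -natrM mulnb.
Qed.

Fact tens_mul_linl t : linear (tens_mul^~ t).
Proof.
move=> a s s'; rewrite /tens_mul scaler_sumr -big_split; apply: eq_bigr => p _.
rewrite scaler_sumr -big_split; apply: eq_bigr => q _ /=.
by rewrite !fmod_coordE mulrDl scalerDl scalerA mulrA.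
Qed.

Fact tens_mul_linr s : linear (tens_mul s).
Proof.
move=> a t t'; rewrite /tens_mul scaler_sumr -big_split; apply: eq_bigr => p _.
rewrite scaler_sumr -big_split; apply: eq_bigr => q _ /=.
by rewrite !fmod_coordE mulrDr scalerDl scalerA mulrCA.
Qed.

Fact lin0 (V W : lmodType F) (f : V -> W) : linear f -> f 0 = 0.
Proof. by move=> fl; have := fl (-1) 0 0; rewrite scaler0 addr0 scaleN1r addNr. Qed.

Lemma tens_mul_base p q : tens_mul (fbase F p) (fbase F q) =
  tens (mon p.1 * mon q.1) (mon p.2 * mon q.2).
Proof.
rewrite /tens_mul; under eq_bigr => p' _ do
  under eq_bigr => q' _ do rewrite -scalerA.
under eq_bigr => p' _ do rewrite -scaler_sumr fbase_sum.
exact: (fbase_sum (fun p' => tens (mon p'.1 * mon q.1) (mon p'.2 * mon q.2))).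
Qed.

Lemma tens_mul_tens h k h' k' :
  tens_mul (tens h k) (tens h' k') = tens (h * h') (k * k').
Proof.
elim/fmod_elim: h => [|a h l IHh IHl|p].
- by rewrite mul0r !tens0l (lin0 (tens_mul_linl _)).
- by rewrite tens_linl tens_mul_linl IHh IHl mulrDl -scalerAl tens_linl.
elim/fmod_elim: k => [|a k l IHk IHl|q].
- by rewrite mul0r !tens0r (lin0 (tens_mul_linl _)).
- by rewrite tens_linr tens_mul_linl IHk IHl mulrDl -scalerAl tens_linr.
elim/fmod_elim: h' => [|a h l IHh IHl|p'].
- by rewrite mulr0 !tens0l (lin0 (tens_mul_linr _)).
- by rewrite tens_linl tens_mul_linr IHh IHl mulrDr -scalerAr tens_linl.
elim/fmod_elim: k' => [|a k l IHk IHl|q'].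
- by rewrite mulr0 !tens0r (lin0 (tens_mul_linr _)).
- by rewrite tens_linr tens_mul_linr IHk IHl mulrDr -scalerAr tens_linr.
have tb u v : tens (fbase F u) (fbase F v) = fbase F (u, v) by rewrite fbase_tens.
by rewrite !tb tens_mul_base.
Qed.

Lemma tens_elim (P : DT2x2 F -> Prop) :
  P 0 -> (forall a s t, P s -> P t -> P (a *: s + t)) ->
  (forall h k, P (tens h k)) -> forall t, P t.
Proof.
by move=> P0 PD Pt; apply: fmod_elim => // p; rewrite fbase_tens; apply: Pt.
Qed.

Fact tens_mulA : associative tens_mul.
Proof.
move=> r s t.
elim/tens_elim: r => [|a r r' IH IH'|h k].
- by rewrite !(lin0 (tens_mul_linl _)).
- by rewrite !tens_mul_linl IH IH'.
elim/tens_elim: s => [|a r r' IH IH'|h' k'].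
- by rewrite ?(lin0 (tens_mul_linl _)) ?(lin0 (tens_mul_linr _)) ?(lin0 (tens_mul_linl _)).
- by rewrite tens_mul_linl !tens_mul_linr tens_mul_linl IH IH'.
elim/tens_elim: t => [|a r r' IH IH'|h'' k''].
- by rewrite !(lin0 (tens_mul_linr _)).
- by rewrite !tens_mul_linr IH IH'.
by rewrite !tens_mul_tens !mulrA.
Qed.

Fact tens_mul1l : left_id tens_one tens_mul.
Proof.
elim/tens_elim => [|a r r' IH IH'|h k].
- by rewrite (lin0 (tens_mul_linr _)).
- by rewrite tens_mul_linr IH IH'.
by rewrite tens_mul_tens !mul1r.
Qed.

Fact tens_mulr1 : right_id tens_one tens_mul.
Proof.
elim/tens_elim => [|a r r' IH IH'|h k].
- by rewrite (lin0 (tens_mul_linl _)).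
- by rewrite tens_mul_linl IH IH'.
by rewrite tens_mul_tens !mulr1.
Qed.

Fact tens_mulDl : left_distributive tens_mul +%R.
Proof. by move=> r s t; have := tens_mul_linl t 1 r s; rewrite !scale1r. Qed.
Fact tens_mulDr : right_distributive tens_mul +%R.
Proof. by move=> r s t; have := tens_mul_linr r 1 s t; rewrite !scale1r. Qed.

Fact tens_one_neq0 : tens_one != 0.
Proof.
pose p := (false, false, false, false).
apply/eqP => /(congr1 (fun t : DT2x2 F => coord t (p, p))).
by rewrite !coordE eqxx mulr1 => /eqP; rewrite oner_eq0.
Qed.

HB.instance Definition _ := GRing.Zmodule_isNzRing.Build (DT2x2 F)
  tens_mulA tens_mul1l tens_mulr1 tens_mulDl tens_mulDr tens_one_neq0.

Fact tens_mulZl a s t : a *: (s * t) = (a *: s) * t.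
Proof. by have := tens_mul_linl t a s 0; rewrite (lin0 (tens_mul_linl _)) !addr0. Qed.
Fact tens_mulZr a s t : a *: (s * t) = s * (a *: t).
Proof. by have := tens_mul_linr s a t 0; rewrite (lin0 (tens_mul_linr _)) !addr0. Qed.

HB.instance Definition _ := GRing.Lmodule_isLalgebra.Build F (DT2x2 F) tens_mulZl.
HB.instance Definition _ := GRing.Lalgebra_isAlgebra.Build F (DT2x2 F) tens_mulZr.

Lemma tensM h k h' k' : tens h k * tens h' k' = tens (h * h') (k * k').
Proof. exact: tens_mul_tens. Qed.

End Tensor.

Lemma skew_relations (F : fieldType) (S T : algType F) (t : S -> S -> T) g G x X :
  (forall k, linear (t^~ k)) -> (forall h, linear (t h)) ->
  (forall h k h' k', t h k * t h' k' = t (h * h') (k * k')) -> t 1 1 = 1 ->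
  DT2_relations g G x X ->
  DT2_relations (t g g) (t G G) (t x 1 + t g x) (t X 1 + t G X).
Proof.
move=> tl tr tM t1 [[gg GG xx XX] [gG gx Gx] [gX GX] xX].
have t0l k : t 0 k = 0 by exact: lin0 (tl k).
have t0r h : t h 0 = 0 by exact: lin0 (tr h).
have tDl h k l : t (h + k) l = t h l + t k l.
  by have := tl l 1 h k; rewrite !scale1r.
have tDr h k l : t h (k + l) = t h k + t h l.
  by have := tr h 1 k l; rewrite !scale1r.
have tNl h k : t (- h) k = - t h k.
  by apply: (addrI (t h k)); rewrite -tDl !subrr t0l.
have tNr h k : t h (- k) = - t h k.
  by apply: (addrI (t h k)); rewrite -tDr !subrr t0r.
split; [split|split|split|].
- by rewrite tM gg.
- by rewrite tM GG.
- by rewrite mulrDl !mulrDr !tM !mulr1 !mul1r !xx gg gx tNl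
    t0l t0r add0r addr0 subrr.
- by rewrite mulrDl !mulrDr !tM !mulr1 !mul1r !XX GG GX tNl
    t0l t0r add0r addr0 subrr.
- by rewrite !tM gG.
- by rewrite mulrDl mulrDr !tM !mulr1 !mul1r gx tNl tNr opprD.
- by rewrite mulrDl mulrDr !tM !mulr1 !mul1r Gx gG tNl tNr opprD.
- by rewrite mulrDl mulrDr !tM !mulr1 !mul1r gX gG tNl tNr opprD.
- by rewrite mulrDl mulrDr !tM !mulr1 !mul1r GX tNl tNr opprD.
have sumE (V : zmodType) (a b c d a' d' : V) :
    a + b + (- c + d) + (a' + c + (- b + d')) = (a + a') + (d + d').
  rewrite addrACA [a + b + _]addrACA [- c + d + _]addrACA -opprD [c + b]addrC.
  by rewrite -addrA addNKr.
rewrite !mulrDl !mulrDr !tM !mulr1 !mul1r gX Gx -gG !tNl sumE.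
by rewrite -tDl -tDr xX tDr tNr tDl tNl t1 addrA subrK.
Qed.

Section Bialgebra.
Variable F : fieldType.
Local Notation g := (gD F).
Local Notation G := (GD F).
Local Notation x := (xD F).
Local Notation X := (XD F).

Definition comul : DT2 F -> DT2x2 F :=
  DT2_lift (tens g g) (tens G G) (tens x 1 + tens g x) (tens X 1 + tens G X).

Definition counit : DT2 F -> F := DT2_lift (1 : F^o) 1 0 0.

Lemma comul_relations : DT2_relations
  (tens g g) (tens G G) (tens x 1 + tens g x) (tens X 1 + tens G X).
Proof.
apply: skew_relations (DT2_relationsP F) => //; first exact: tens_linl.
  exact: tens_linr.
exact: tensM.
Qed.

Lemma comul_gen :
  [/\ comul g = tens g g, comul G = tens G G,
      comul x = tens x 1 + tens g x & comul X = tens X 1 + tens G X].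
Proof. by case: (DT2_universal comul_relations). Qed.

Lemma comul_morphism : linear comul /\ monoid_morphism comul.
Proof. by case: (DT2_universal comul_relations). Qed.

Lemma counit_relations : DT2_relations (1 : F^o) 1 0 0.
Proof.
by split; [split|split|split|]; rewrite ?mulr1 ?mulr0 ?mul0r ?oppr0 ?addr0 ?subrr.
Qed.

Lemma counit_gen : [/\ counit g = 1, counit G = 1, counit x = 0 & counit X = 0].
Proof. by case: (DT2_universal counit_relations). Qed.

Lemma counit_morphism :
  linear (counit : DT2 F -> F^o) /\ monoid_morphism (counit : DT2 F -> F^o).
Proof. by case: (DT2_universal counit_relations). Qed.

(* \sum f h_(1) h_(2), for f bilinear.                                        *)
Definition sweedler (V : lmodType F) (f : DT2 F -> DT2 F -> V) (h : DT2 F) : V :=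
  \sum_p coord (comul h) p *: f (mon F p.1) (mon F p.2).

Section Actions.
Variable R : algType F.
Implicit Types (act : DT2 F -> R -> R) (u v : DT2 F -> R).

(* act h a is h * a; this makes R an H-module algebra for H = D(T_2).         *)
Definition is_action act : Prop :=
  [/\ forall h, linear (act h), forall a, linear (act^~ a),
      [/\ forall a, act 1 a = a & forall h k a, act (h * k) a = act h (act k a)],
      forall h, act h 1 = (counit h)%:A &
      forall h a b, act h (a * b) = sweedler (fun h1 h2 => act h1 a * act h2 b) h].

Definition conv_inverse u v : Prop :=
  forall h, sweedler (fun h1 h2 => u h1 * v h2) h = (counit h)%:A /\
            sweedler (fun h1 h2 => v h1 * u h2) h = (counit h)%:A.

Definition inner_via act u : Prop :=
  [/\ linear u, u 1 = 1 &
      exists v, [/\ linear v, conv_inverse u v &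
        forall h a, act h a = sweedler (fun h1 h2 => u h1 * a * v h2) h]].

Definition algebra_automorphism (phi : R -> R) : Prop :=
  [/\ linear phi, monoid_morphism phi & bijective phi].

Definition action_iso (act act' : DT2 F -> R -> R) : Prop :=
  exists2 phi, algebra_automorphism phi &
    forall h a, act' h (phi a) = phi (act h a).

Definition anticommuting u : Prop :=
  [/\ u g * u x = - (u x * u g), u G * u x = - (u x * u G),
      u g * u X = - (u X * u g) & u G * u X = - (u X * u G)].

End Actions.
End Bialgebra.

Section StandardForm.
Variable F : fieldType.

Definition mx22 (a b c d : F) : 'M[F]_2 := \matrix_(i < 2, j < 2)
  if i == 0 then if j == 0 then a else b else if j == 0 then c else d.

Definition matA : 'M[F]_2 := mx22 1 0 0 (-1).
Definition matB : 'M[F]_2 := mx22 0 1 1 0.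
Definition matC : 'M[F]_2 := mx22 0 1 (-1) 0.

(* Here k = r + r.                                                            *)
Definition std_g r : 'M[F]_((r + r) * 2) := (1%:M : 'M_(r + r)) *t matA.
Definition std_G r : 'M[F]_((r + r) * 2) := (1%:M : 'M_(r + r)) *t matB.
Definition std_x r : 'M[F]_((r + r) * 2) :=
  (block_mx 0 1%:M 0 0 : 'M_(r + r)) *t matC.
Definition std_X r (tau : F) : 'M[F]_((r + r) * 2) :=
  (block_mx 0 (tau *: 1%:M) (- 1%:M) 0 : 'M_(r + r)) *t matC.

Definition is_standard n r (e : ((r + r) * 2)%N = n.+1) (tau : F)
    (act : DT2 F -> 'M[F]_n.+1 -> 'M[F]_n.+1) : Prop :=
  is_action act /\
  exists2 u : DT2 F -> 'M[F]_n.+1, inner_via act u &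
    [/\ u (gD F) = castmx (e, e) (std_g r),
        u (GD F) = castmx (e, e) (std_G r),
        u (xD F) = castmx (e, e) (std_x r) &
        u (XD F) = castmx (e, e) (std_X r tau)].

End StandardForm.

(* Main.v *)
From HB Require Import structures.
From mathcomp Require Import all_boot all_order all_algebra.
From mathcomp Require Import ring.
From mathcomp.real_closed Require Import mxtens.
Require Import Defs.

Set Implicit Arguments.
Unset Strict Implicit.
Unset Printing Implicit Defensive.

Import GRing.Theory.
Local Open Scope ring_scope.

(* Write a, b, x, X for the values of u at the generators.  Acting by the     *)
(* relations of D(T_2) shows that a^2, b^2, x^2, X^2 are scalars and ab = -ba *)
(* (central matrices are scalar), and that xX + Xx - 1 is a multiple of ab;   *)
(* as xX + Xx commutes with a while ab anticommutes with it, xX + Xx = 1.     *)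
(* Rescaling gives a^2 = b^2 = 1, and nilpotency gives x^2 = 0; the only      *)
(* remaining invariant is tau = X^2.  Then f = xX(1 + a)/2 is an idempotent,  *)
(* and 1 is the sum of f, bfb, Xfx and bXfxb, which are orthogonal and of the *)
(* same rank.  So an isomorphism between the images of f in two quadruples    *)
(* with the same tau extends to a simultaneous conjugation.  For uniqueness,  *)
(* an inner action determines u(X) (resp. u(x)) among the elements            *)
(* anticommuting with u(G) (resp. u(g)), hence determines tau = u(X)^2.       *)

(** Structurally, four matrices satisfying [quad_rel] are a representation of a Clifford algebra:
    the generators anticommute pairwise except for xX + Xx = 1, and the quadratic form is
    nondegenerate of rank 4. This algebra is a copy of the 4 by 4 matrices with f as a primitive
    idempotent, so for fixed tau a representation is determined by r = rank f and has dimension 4r.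
    [quad_conj] and [quad_std] prove this by explicit matrices.

    [rescale_inner] normalizes u without changing the action, and [inner_quad_rel] then produces the
    quadruple. Conjugation by the matrix from [quad_std] transports the action to a standard one.
    Uniqueness is [standard_tau], which rests on [skew_inner_inj], followed by [standard_uniq]. *)

Section Conjugacy.
Variable F : fieldType.
Hypothesis nz2 : 2%:R != 0 :> F.

(** Relations for the normalized values of u at g, G, x, X. Unlike in D(T_2), a and b anticommute, X
    squares to a scalar and xX + Xx is 1. *)
Definition quad_rel m (tau : F) (a b x X : 'M[F]_m) : Prop :=
  [/\ [/\ a *m a = 1%:M, b *m b = 1%:M, x *m x = 0 & X *m X = tau%:M],
      [/\ a *m b = - (b *m a), a *m x = - (x *m a) & b *m x = - (x *m b)],
      [/\ a *m X = - (X *m a) & b *m X = - (X *m b)] &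
      x *m X + X *m x = 1%:M].

(** The arbitrary right factor gives every right-nested word a tail, so one form of each rewriting
    rule covers all positions in a word. *)
Lemma eq_mulmxr m n (A B : 'M[F]_(m, n)) :
  (forall Z : 'M_n, A *m Z = B *m Z) -> A = B.
Proof. by move=> AB; rewrite -[A]mulmx1 AB mulmx1. Qed.

Lemma mxDE m n (A B : 'M[F]_(m, n)) i j : (A + B) i j = A i j + B i j.
Proof. by rewrite mxE. Qed.
Lemma mxNE m n (A : 'M[F]_(m, n)) i j : (- A) i j = - A i j.
Proof. by rewrite mxE. Qed.
Lemma mxZE m n c (A : 'M[F]_(m, n)) i j : (c *: A) i j = c * A i j.
Proof. by rewrite mxE. Qed.
Lemma mx0E m n i j : (0 : 'M[F]_(m, n)) i j = 0.
Proof. by rewrite mxE. Qed.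
Definition mx_linE := (mxDE, mxNE, mxZE, mx0E).

Definition mulmx_linE := (mulmxDl, mulmxDr, mulNmx, mulmxN, mulmx0, mul0mx).

Lemma mulmx_sq m k (A B : 'M[F]_m) (C : 'M_m) (Z : 'M_(m, k)) :
  A *m B = C -> A *m (B *m Z) = C *m Z.
Proof. by rewrite mulmxA => ->. Qed.

Lemma mulmx_anti m k (A B : 'M[F]_m) (Z : 'M_(m, k)) :
  A *m B = - (B *m A) -> A *m (B *m Z) = - (B *m (A *m Z)).
Proof. by move=> AB; rewrite mulmxA AB mulNmx mulmxA. Qed.

Lemma anti_sym m (A B : 'M[F]_m) : A *m B = - (B *m A) -> B *m A = - (A *m B).
Proof. by move->; rewrite opprK. Qed.

(** * The idempotent of a quadruple *)

Section Quad.
Variables (m : nat) (tau : F) (a b x X : 'M[F]_m).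
Hypothesis rel : quad_rel tau a b x X.

(* Words acting on the image of f are normalized in the order b, X, x, a as a *)
(* and x act trivially there; words following the projection onto that image  *)
(* are normalized in the order a, X, x, b (quad_right).                       *)
Lemma quad_left k (Z : 'M[F]_(m, k)) :
  ((a *m (a *m Z) = Z) * (b *m (b *m Z) = Z) * (x *m (x *m Z) = 0) *
   (X *m (X *m Z) = tau *: Z) * (a *m (b *m Z) = - (b *m (a *m Z))) *
   (a *m (x *m Z) = - (x *m (a *m Z))) * (a *m (X *m Z) = - (X *m (a *m Z))) *
   (x *m (b *m Z) = - (b *m (x *m Z))) * (X *m (b *m Z) = - (b *m (X *m Z))) *
   (x *m (X *m Z) = Z - X *m (x *m Z)))%type.
Proof.
case: rel => -[aa bb xx XX] [ab ax bx] [aX bX] xX.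
do 9?split; try exact: mulmx_anti; try exact: mulmx_anti (anti_sym _).
- by rewrite (mulmx_sq _ aa) mul1mx.
- by rewrite (mulmx_sq _ bb) mul1mx.
- by rewrite (mulmx_sq _ xx) mul0mx.
- by rewrite (mulmx_sq _ XX) mul_scalar_mx.
by rewrite !mulmxA -[in LHS](addrK (X *m x) (x *m X)) xX mulmxBl mul1mx.
Qed.

Lemma quad_right k (Z : 'M[F]_(m, k)) :
  ((a *m (a *m Z) = Z) * (b *m (b *m Z) = Z) * (x *m (x *m Z) = 0) *
   (X *m (X *m Z) = tau *: Z) * (b *m (a *m Z) = - (a *m (b *m Z))) *
   (x *m (a *m Z) = - (a *m (x *m Z))) * (X *m (a *m Z) = - (a *m (X *m Z))) *
   (b *m (x *m Z) = - (x *m (b *m Z))) * (b *m (X *m Z) = - (X *m (b *m Z))) *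
   (x *m (X *m Z) = Z - X *m (x *m Z)))%type.
Proof. by do 9?split; rewrite !quad_left ?opprK. Qed.

(** Since x^2 = 0 and xX + Xx = 1, xX is a projection onto the kernel of x; it commutes with the
    projection (1 + a)/2. The product projects onto the common part of ker x and ker (a - 1). *)
Definition quad_idem : 'M[F]_m := 2^-1 *: (x *m X + x *m X *m a).

Lemma quad_idemE k (Z : 'M[F]_(m, k)) : quad_idem *m Z =
  2^-1 *: (Z + a *m Z - X *m (x *m Z) - X *m (x *m (a *m Z))).
Proof.
rewrite /quad_idem -scalemxAl !mulmx_linE -!mulmxA !quad_left.
by rewrite addrACA -!addrA.
Qed.

Lemma quad_idem_idem : quad_idem *m quad_idem = quad_idem.
Proof.
apply: eq_mulmxr => Z; rewrite -mulmxA !quad_idemE.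
do 10 rewrite ?mulmx_linE ?scaler0 -?scalemxAl -?scalemxAr ?opprK ?quad_left.
by apply/matrixP => i j; rewrite !mx_linE; field.
Qed.

Section Half.
Variables (r : nat) (M : 'M[F]_(m, r)) (N : 'M[F]_(r, m)).
Hypotheses (MN : M *m N = quad_idem) (NM : N *m M = 1%:M).

Lemma half_aM : a *m M = M.
Proof.
rewrite -[M]mulmx1 -NM !(mulmxA M) MN !quad_idemE.
do 10 rewrite ?mulmx_linE ?scaler0 -?scalemxAl -?scalemxAr ?opprK ?quad_left.
by apply/matrixP => i j; rewrite !mx_linE; field.
Qed.

Lemma half_xM : x *m M = 0.
Proof.
rewrite -[M]mulmx1 -NM !(mulmxA M) MN !quad_idemE.
do 10 rewrite ?mulmx_linE ?scaler0 -?scalemxAl -?scalemxAr ?opprK ?quad_left.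
by apply/matrixP => i j; rewrite !mx_linE; field.
Qed.

Lemma half_Na : N *m a = N.
Proof.
rewrite -[N]mul1mx -NM -!mulmxA ?(mulmxA M) MN; congr (N *m _).
apply: eq_mulmxr => Z; rewrite -!mulmxA !quad_idemE.
do 10 rewrite ?mulmx_linE ?scaler0 -?scalemxAl -?scalemxAr ?opprK ?quad_left.
by apply/matrixP => i j; rewrite !mx_linE; field.
Qed.

(** Both sides come from f x = x(1 - a)/2 and f X = x X^2 (1 - a)/2, with X^2 = tau. *)
Lemma half_NX : N *m X = tau *: (N *m x).
Proof.
rewrite -[N]mul1mx -NM -!mulmxA ?(mulmxA M) MN scalemxAr; congr (N *m _).
apply: eq_mulmxr => Z; rewrite -mulmxA quad_idemE -scalemxAl -mulmxA quad_idemE.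
do 10 rewrite ?mulmx_linE ?scaler0 -?scalemxAl -?scalemxAr ?opprK ?quad_left.
by apply/matrixP => i j; rewrite !mx_linE; field.
Qed.

Lemma half_NbM : N *m (b *m M) = 0.
Proof.
have : N *m (b *m M) = - (N *m (b *m M)).
  (* Insert a after N and move it across b to M, where it disappears; only the sign remains. *)
  by rewrite -{1}half_Na -mulmxA quad_left half_aM mulmxN.
move/eqP; rewrite -addr_eq0 -mulr2n -scaler_nat scaler_eq0 (negbTE nz2).
by move/eqP.
Qed.

Lemma half_inj_rules k (Z : 'M[F]_(r, k)) :
  ((a *m (M *m Z) = M *m Z) * (x *m (M *m Z) = 0) *
   (N *m (M *m Z) = Z) * (N *m (b *m (M *m Z)) = 0) *
   (N *m (x *m (b *m (M *m Z))) = 0))%type.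
Proof.
have xMZ : x *m (M *m Z) = 0 by rewrite mulmxA half_xM mul0mx.
do 4?split=> //; first by rewrite mulmxA half_aM.
- by rewrite mulmxA NM mul1mx.
- by rewrite !mulmxA -(mulmxA N) half_NbM mul0mx.
by rewrite quad_left xMZ mulmx0 oppr0 mulmx0.
Qed.

Lemma half_proj_rules k (Y : 'M[F]_(m, k)) :
  ((N *m (a *m Y) = N *m Y) * (N *m (X *m Y) = tau *: (N *m (x *m Y))) *
   (M *m (N *m Y) =
      2^-1 *: (Y + a *m Y - X *m (x *m Y) - X *m (x *m (a *m Y)))))%type.
Proof.
do 2?split; first by rewrite mulmxA half_Na.
  by rewrite mulmxA half_NX -scalemxAl mulmxA.
by rewrite mulmxA MN quad_idemE.
Qed.

End Half.
End Quad.

(** * Conjugacy of quadruples with equal tau and r *)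

Section Conj.
Variables (m m' : nat) (tau : F) (a b x X : 'M[F]_m) (a' b' x' X' : 'M[F]_m').
Hypothesis rel : quad_rel tau a b x X.
Hypothesis rel' : quad_rel tau a' b' x' X'.
Variables (r : nat) (M : 'M[F]_(m, r)) (N : 'M[F]_(r, m)).
Variables (J : 'M[F]_(m', r)) (K : 'M[F]_(r, m')).
Hypotheses (MN : M *m N = quad_idem a x X) (NM : N *m M = 1%:M).
Hypotheses (JK : J *m K = quad_idem a' x' X') (KJ : K *m J = 1%:M).

Let L := quad_left rel.
Let R := quad_right rel'.
Let LM := half_inj_rules rel MN NM.
Let LN := half_proj_rules rel MN NM.
Let RJ := half_inj_rules rel' JK KJ.
Let RK := half_proj_rules rel' JK KJ.
(** The primed space is the direct sum of the images of J, b'J, X'J and b'X'J, with coordinate maps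
    K, Kb', Kx' and Kx'b'. P sends these pieces to the images of M, bM, XM and bXM; Q goes back. *)
Let P := M *m K + b *m (M *m (K *m b')) +
  X *m (M *m (K *m x')) + b *m (X *m (M *m (K *m (x' *m b')))).
Let Q := J *m N + b' *m (J *m (N *m b)) +
  X' *m (J *m (N *m x)) + b' *m (X' *m (J *m (N *m (x *m b)))).

Ltac norm := do 12 rewrite ?mulmx_linE ?scaler0 -?mulmxA -?scalemxAl -?scalemxAr
  ?opprK ?L ?R ?LM ?LN ?RJ ?RK.

Lemma quad_intertwines :
  [/\ a *m P = P *m a', b *m P = P *m b', x *m P = P *m x' & X *m P = P *m X'].
Proof.
rewrite /P; split; apply: eq_mulmxr => Z; norm;
  by apply/matrixP => i j; rewrite !mx_linE; ring.
Qed.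

(** Terms with mismatched pieces vanish, and what is left is f + bfb + Xfx + bXfxb = 1. *)
Lemma quad_intertwiner_inv : P *m Q = 1%:M.
Proof.
rewrite /P /Q; apply: eq_mulmxr => Z; norm; rewrite mul1mx.
by apply/matrixP => i j; rewrite !mx_linE; field.
Qed.

End Conj.

(** The sizes m and m' are not assumed equal: their equality follows from P and Q being mutually
    inverse. The construction is symmetric, so QP = 1 is PQ = 1 with the quadruples exchanged. *)
Lemma quad_conj m m' tau (a b x X : 'M[F]_m) (a' b' x' X' : 'M[F]_m') r
    (M : 'M[F]_(m, r)) (N : 'M[F]_(r, m))
    (J : 'M[F]_(m', r)) (K : 'M[F]_(r, m')) :
  quad_rel tau a b x X -> quad_rel tau a' b' x' X' ->
  M *m N = quad_idem a x X -> N *m M = 1%:M ->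
  J *m K = quad_idem a' x' X' -> K *m J = 1%:M ->
  exists (P : 'M_(m, m')) (Q : 'M_(m', m)), [/\ P *m Q = 1%:M, Q *m P = 1%:M &
    [/\ a *m P = P *m a', b *m P = P *m b', x *m P = P *m x' &
        X *m P = P *m X']].
Proof.
move=> rel rel' MN NM JK KJ; do 2!eexists; split; last 1 first.
- exact: (quad_intertwines rel rel' MN NM JK KJ).
- exact: (quad_intertwiner_inv rel rel' MN NM JK KJ).
exact: (quad_intertwiner_inv rel' rel JK KJ MN NM).
Qed.

(** Rank factorization f = MN: as M is left cancellable and N right cancellable, MNMN = MN forces NM
    = 1. *)
Lemma idem_split m (f : 'M[F]_m) : f *m f = f ->
  exists r (M : 'M_(m, r)) (N : 'M_(r, m)), M *m N = f /\ N *m M = 1%:M.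
Proof.
move=> ff; exists (\rank f), (col_base f), (row_base f).
split; first exact: mulmx_base.
apply: (row_free_inj (row_base_free f)); apply: (row_full_inj (col_base_full f)).
rewrite -(mulmxA (row_base f)) mul1mx mulmx_base (mulmxA (col_base f)).
by rewrite !mulmx_base ff.
Qed.

(** * The standard quadruple *)

Lemma tensmxDl m n p q (A B : 'M[F]_(m, n)) (C : 'M[F]_(p, q)) :
  (A + B) *t C = A *t C + B *t C.
Proof. by apply/matrixP => i j; rewrite !mxE mulrDl. Qed.

Lemma tensmxZl m n p q c (A : 'M[F]_(m, n)) (C : 'M[F]_(p, q)) :
  (c *: A) *t C = c *: (A *t C).
Proof. by apply/matrixP => i j; rewrite !mxE mulrA. Qed.

Lemma tensmxDr m n p q (A : 'M[F]_(m, n)) (B C : 'M[F]_(p, q)) :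
  A *t (B + C) = A *t B + A *t C.
Proof. by apply/matrixP => i j; rewrite !mxE mulrDr. Qed.

Lemma tensmxZr m n p q c (A : 'M[F]_(m, n)) (C : 'M[F]_(p, q)) :
  A *t (c *: C) = c *: (A *t C).
Proof. by apply/matrixP => i j; rewrite !mxE mulrCA. Qed.

Lemma tensmxNr m n p q (A : 'M[F]_(m, n)) (C : 'M[F]_(p, q)) :
  A *t (- C) = - (A *t C).
Proof. by rewrite -scaleN1r tensmxZr scaleN1r. Qed.

Lemma tensmx11 m n : (1%:M : 'M[F]_m) *t (1%:M : 'M[F]_n) = 1%:M.
Proof.
apply/matrixP => i j; case: (mxtens_indexP i) => i1 i2.
case: (mxtens_indexP j) => j1 j2; rewrite tensmxE !mxE.
rewrite (can_eq (@mxtens_indexK m n)) xpair_eqE.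
by case: (i1 == j1); case: (i2 == j2); rewrite /= ?mulr1 ?mulr0.
Qed.

Lemma mx22P (A : 'M[F]_2) : A = mx22 (A 0 0) (A 0 1) (A 1 0) (A 1 1).
Proof.
apply/matrixP => i j; rewrite mxE.
by case: i j => [[|[|[]]] // ?] [[|[|[]]] // ?] /=; congr (A _ _); apply: val_inj.
Qed.

Lemma mx22M a b c d a' b' c' d' : mx22 a b c d *m mx22 a' b' c' d' =
  mx22 (a * a' + b * c') (a * b' + b * d') (c * a' + d * c') (c * b' + d * d') :> 'M[F]_2.
Proof.
rewrite [LHS]mx22P; congr mx22;
  by rewrite !mxE !big_ord_recl big_ord0 !mxE /= addr0.
Qed.

Lemma mx22N a b c d : - mx22 a b c d = mx22 (- a) (- b) (- c) (- d) :> 'M[F]_2.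
Proof. by rewrite [LHS]mx22P; congr mx22; rewrite !mxE. Qed.

Lemma mx22_1 : 1%:M = mx22 1 0 0 1 :> 'M[F]_2.
Proof. by rewrite [LHS]mx22P; congr mx22; rewrite !mxE. Qed.

Lemma matABC : [/\ matA F *m matA F = 1%:M, matB F *m matB F = 1%:M,
    matC F *m matC F = - 1%:M &
    [/\ matA F *m matB F = - (matB F *m matA F),
        matA F *m matC F = - (matC F *m matA F) &
        matB F *m matC F = - (matC F *m matB F)]].
Proof.
by do ?split; rewrite /matA /matB /matC ?mx22_1 !mx22M ?mx22N; congr mx22; ring.
Qed.

Lemma std_rel r tau :
  quad_rel tau (std_g F r) (std_G F r) (std_x F r) (std_X r tau).
Proof.
have [AA BB CC [AB AC BC]] := matABC.
rewrite /quad_rel /std_g /std_G /std_x /std_X !tensmx_mul.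
rewrite AA BB CC AB AC BC !mulmx1 !mul1mx !tensmxNr tensmx11 -!tensmxNr.
do 2?split=> //.
- by rewrite mulmx_block !(mulmx0, mul0mx) !addr0 block_mx0 tens0mx.
- rewrite mulmx_block !(mulmx0, mul0mx) !(addr0, add0r) mulmxN mulmx1 mulNmx mul1mx.
  rewrite tensmxNr -scaleN1r -tensmxZl scale_block_mx !scaler0 !scaleN1r opprK.
  rewrite -[in LHS](scaler0 _ tau) -scale_block_mx -scalar_mx_block tensmxZl tensmx11.
  by rewrite scalemx1.
rewrite -tensmxDl !mulmx_block !(mulmx0, mul0mx, mulmx1, mul1mx, addr0, add0r).
rewrite add_block_mx !(addr0, add0r) tensmxNr -scaleN1r -tensmxZl.
by rewrite scale_block_mx !scaler0 scaleN1r opprK -scalar_mx_block tensmx11.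
Qed.

(** Here xX is the upper left block projection tensored with 1, because C^2 = -1, and (1 + A)/2 is
    the matrix unit at (0, 0). Hence f has rank r for every tau. *)
Lemma std_idem r tau : exists (J : 'M[F]_((r + r) * 2, r)) (K : 'M_(r, (r + r) * 2)),
  J *m K = quad_idem (std_g F r) (std_x F r) (std_X r tau) /\ K *m J = 1%:M.
Proof.
suff: exists (J : 'M[F]_((r + r) * 2, r * 1)) (K : 'M_(r * 1, (r + r) * 2)),
  J *m K = quad_idem (std_g F r) (std_x F r) (std_X r tau) /\ K *m J = 1%:M.
  by rewrite muln1.
pose e : 'M[F]_(2, 1) := delta_mx 0 0.
exists (col_mx 1%:M 0 *t e), (row_mx 1%:M 0 *t e^T).
rewrite /quad_idem /std_g /std_x /std_X !tensmx_mul.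
have [_ _ -> _] := matABC; rewrite !mulmx1; split; last first.
  rewrite mul_row_col mulmx1 mulmx0 addr0 /e trmx_delta mul_delta_mx.
  rewrite -tensmx11; congr (_ *t _).
  by apply/matrixP => i j; rewrite !mxE !ord1.
rewrite mul_col_row mulmx_block !(mulmx0, mul0mx, mulmx1, addr0, add0r).
set p := block_mx _ _ _ _; set q := block_mx _ _ _ _.
have -> : q = - p.
  by rewrite /p /q mulmxN mulmx1 -[RHS]scaleN1r scale_block_mx !scaler0 scaleN1r.
rewrite -tensmxDr -tensmxZr -scaleN1r tensmxZl -tensmxZr; congr (_ *t _).
rewrite /e trmx_delta mul_delta_mx mulNmx mul1mx.
by apply/matrixP => -[[|[|[]]] // ?] [[|[|[]]] // ?]; rewrite !mxE /=; field.
Qed.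

(** Take r to be the rank of f and compare with the standard quadruple for that r, whose idempotent
    has the same rank. *)
Lemma quad_std m tau (a b x X : 'M[F]_m) : quad_rel tau a b x X ->
  exists r (e : ((r + r) * 2)%N = m) (P Q : 'M_m), [/\ P *m Q = 1%:M, Q *m P = 1%:M &
    [/\ a *m P = P *m castmx (e, e) (std_g F r),
        b *m P = P *m castmx (e, e) (std_G F r),
        x *m P = P *m castmx (e, e) (std_x F r) &
        X *m P = P *m castmx (e, e) (std_X r tau)]].
Proof.
move=> rel; have [r [M [N [MN NM]]]] := idem_split (quad_idem_idem rel).
have [J [K [JK KJ]]] := std_idem r tau.
have [P [Q [PQ QP com]]] := quad_conj rel (std_rel r tau) MN NM JK KJ.
have e : ((r + r) * 2)%N = m.
  by apply/eqP; rewrite eqn_leq (mulmx1_min PQ) (mulmx1_min QP).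
exists r, e; clear rel M N MN NM JK KJ; case: m / e a b x X P Q PQ QP com.
by move=> a b x X P Q PQ QP com; exists P, Q; rewrite !castmx_id.
Qed.

End Conjugacy.

(** * The coproduct on the monomial basis *)

Section MonomialCoproduct.
Variable F : fieldType.
Local Notation g := (gD F).
Local Notation G := (GD F).
Local Notation x := (xD F).
Local Notation X := (XD F).
Local Notation mon := (mon F).

(** The linear map on the tensor square attached to f; [sweedler f] is its composite with
    [comul]. *)
Definition tsum (V : lmodType F) (f : DT2 F -> DT2 F -> V) (t : DT2x2 F) : V :=
  \sum_p coord t p *: f (mon p.1) (mon p.2).

Lemma tsum_linear (V : lmodType F) (f : DT2 F -> DT2 F -> V) : linear (tsum f).
Proof.
move=> c s t; rewrite /tsum scaler_sumr -big_split; apply: eq_bigr => p _ /=.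
by rewrite !fmod_coordE scalerDl scalerA.
Qed.
HB.instance Definition _ (V : lmodType F) (f : DT2 F -> DT2 F -> V) :=
  GRing.isLinear.Build F (DT2x2 F) V *:%R (tsum f) (tsum_linear f).

Lemma linear_fbase (V : lmodType F) (f : DT2 F -> V) h :
  linear f -> f h = \sum_p coord h p *: f (mon p).
Proof.
move=> fl; pose fL := GRing.isLinear.Build F (DT2 F) V *:%R f fl.
pose ff : {linear DT2 F -> V} := HB.pack f fL.
by rewrite {1}[h]fmod_sum [LHS](linear_sum ff); under eq_bigr do rewrite linearZ.
Qed.

Lemma linear_eq_mon (V : lmodType F) (f f' : DT2 F -> V) :
  linear f -> linear f' -> (forall p, f (mon p) = f' (mon p)) -> f =1 f'.
Proof.
move=> fl fl' ff h; rewrite (linear_fbase h fl) (linear_fbase h fl').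
by apply: eq_bigr => p _; rewrite ff.
Qed.

Lemma tsum_tens (V : lmodType F) (f : DT2 F -> DT2 F -> V) h k :
  (forall k, linear (f^~ k)) -> (forall h, linear (f h)) -> tsum f (tens h k) = f h k.
Proof.
move=> fl fr; symmetry.
transitivity (\sum_p \sum_q (coord h p * coord k q) *: f (mon p) (mon q)).
  rewrite (linear_fbase h (fl k)); apply: eq_bigr => p _.
  rewrite (linear_fbase k (fr _)) scaler_sumr.
  by apply: eq_bigr => q _; rewrite scalerA.
by rewrite pair_bigA; apply: eq_bigr => -[p q] _; rewrite coordE.
Qed.

Lemma sweedler_linear (V : lmodType F) (f : DT2 F -> DT2 F -> V) : linear (sweedler f).
Proof.
move=> c h k; have [cl _] := comul_morphism F.
by rewrite -![sweedler f _]/(tsum f _) cl linearP.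
Qed.

Lemma eq_sweedler (V : lmodType F) (f f' : DT2 F -> DT2 F -> V) h :
  (forall p q, f (mon p) (mon q) = f' (mon p) (mon q)) -> sweedler f h = sweedler f' h.
Proof. by move=> ff; apply: eq_bigr => p _; rewrite ff. Qed.

Lemma tensNl (h k : DT2 F) : tens (- h) k = - tens h k.
Proof. by apply/fmodP => p; rewrite !fmod_coordE mulNr. Qed.

Lemma mon_gpM a b p : mon (a, b, false, false) * mon p =
  (let: (a', b', c, d) := p in mon (a (+) a', b (+) b', c, d)).
Proof.
case: p => [[[a' b'] c] d]; rewrite [LHS]opeval_mon /=.
by case: a; case: b; rewrite /= ?LG_mon ?Lg_mon /= ?negbK.
Qed.

(** The bits i and j record whether x and X are taken in the right factor; each one taken there
    leaves g, respectively G, on the left. The sign comes from moving that G across an x on the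
    left. *)
Lemma comul_mon a b c d : comul (mon (a, b, c, d)) =
  \sum_(i : bool | i ==> c) \sum_(j : bool | j ==> d)
    (-1) ^+ ((c (+) i) && j) *:
       tens (mon (a (+) i, b (+) j, c (+) i, d (+) j)) (mon (a, b, i, j)).
Proof.
have [_ [c1 cM]] := comul_morphism F; have [cg cG cx cX] := comul_gen F.
have cE (y : DT2 F) (n : bool) : comul (y ^+ n) = comul y ^+ n.
  by case: n; rewrite ?expr0 ?expr1 ?c1.
rewrite monE !cM !cE cg cG cx cX.
have -> : tens g g ^+ a * tens G G ^+ b =
    tens (mon (a, b, false, false)) (mon (a, b, false, false)).
  by case: a; case: b; rewrite ?expr0 ?expr1 ?mulr1 ?mul1r ?tensM ?gDM ?Lg_mon.
rewrite -mulrA big_mkcond big_bool /= !(big_mkcond (fun j => j ==> d)) !big_bool /=.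
have W := (gDM, xDM, Lg_mon, Lx_mon, mon_gpM).
case: c; case: d; rewrite ?expr0 ?expr1 ?mulr1 ?mul1r ?(mulrDl, mulrDr) ?tensM
  ?mulr1 ?mul1r ?W /= ?expr0 ?expr1 ?scale1r ?scaleN1r ?mulrN ?tensNl ?W
  ?addbF ?addbT ?addr0 ?add0r.
- rewrite [RHS]addrC (addrC (- _)).
  by rewrite (addrC (tens (mon (~~ a, ~~ b, _, _)) _)).
- by rewrite [RHS]addrC.
- by rewrite [RHS]addrC.
by [].
Qed.

End MonomialCoproduct.

(** * Inner actions: generators, rescaling, transport *)

Section InnerActions.
Variable F : fieldType.
Local Notation g := (gD F).
Local Notation G := (GD F).
Local Notation x := (xD F).
Local Notation X := (XD F).
Local Notation mon := (mon F).

Section Algebras.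
Variable R : algType F.
Implicit Types (act : DT2 F -> R -> R) (u v : DT2 F -> R).

Lemma conj_linearl u c v k : linear u -> linear ((fun h k => u h * c * v k)^~ k).
Proof. by move=> ul s h h'; rewrite ul !mulrDl -!scalerAl. Qed.

Lemma conj_linearr u c v h : linear v -> linear ((fun h k => u h * c * v k) h).
Proof. by move=> vl s k k'; rewrite vl mulrDr -scalerAr. Qed.

Lemma sweedler_mon u c v a b s t : linear u -> linear v ->
  sweedler (fun h k => u h * c * v k) (mon (a, b, s, t)) =
  \sum_(i : bool | i ==> s) \sum_(j : bool | j ==> t) (-1) ^+ ((s (+) i) && j) *:
    (u (mon (a (+) i, b (+) j, s (+) i, t (+) j)) * c * v (mon (a, b, i, j))).
Proof.
move=> ul vl; rewrite -[LHS]/(tsum _ (comul _)) comul_mon linear_sum.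
apply: eq_bigr => i _; rewrite linear_sum; apply: eq_bigr => j _.
by rewrite linearZ /= tsum_tens // => *; [exact: conj_linearl | exact: conj_linearr].
Qed.

Lemma sweedler_gen u c v : linear u -> linear v ->
  let f h k := u h * c * v k in
  [/\ sweedler f 1 = f 1 1, sweedler f g = f g g, sweedler f G = f G G,
      sweedler f x = f x 1 + f g x & sweedler f X = f X 1 + f G X].
Proof.
move=> ul vl f; have [cg cG cx cX] := comul_gen F.
have [_ [c1 _]] := comul_morphism F.
have ft h k : tsum f (tens h k) = f h k.
  by apply: tsum_tens => ?; [exact: conj_linearl | exact: conj_linearr].
by split; rewrite -[LHS]/(tsum _ (comul _)) ?c1 ?cg ?cG ?cx ?cX ?linearD /= -?ft.
Qed.

(** The convolution inverse v inverts u at the group-likes, and evaluating u * v at x and X, where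
    the counit vanishes, gives v(x) = - v(g) u(x) and v(X) = - v(G) u(X). *)
Lemma inner_gen act u : inner_via act u -> exists w W : R,
  [/\ u g * w = 1 /\ w * u g = 1, u G * W = 1 /\ W * u G = 1 &
   [/\ forall c, act g c = u g * c * w, forall c, act G c = u G * c * W,
       forall c, act x c = u x * c - u g * c * w * u x &
       forall c, act X c = u X * c - u G * c * W * u X]].
Proof.
move=> [ul u1 [v [vl uv actE]]].
have E1 h : sweedler (fun h1 h2 => u h1 * 1 * v h2) h = (counit h)%:A.
  by rewrite -(uv h).1; apply: eq_sweedler => p q; rewrite mulr1.
have E2 h : sweedler (fun h1 h2 => v h1 * 1 * u h2) h = (counit h)%:A.
  by rewrite -(uv h).2; apply: eq_sweedler => p q; rewrite mulr1.
have [eg eG ex eX] := counit_gen F; have [_ [e1 _]] := counit_morphism F.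
have [u11 ug uG ux uX] := sweedler_gen 1 ul vl.
have [_ vg vG _ _] := sweedler_gen 1 vl ul.
rewrite E1 e1 scale1r u1 !mul1r in u11.
rewrite E1 eg scale1r mulr1 in ug; rewrite E1 eG scale1r mulr1 in uG.
rewrite E1 ex scale0r !mulr1 -u11 mulr1 in ux.
rewrite E1 eX scale0r !mulr1 -u11 mulr1 in uX.
rewrite E2 eg scale1r mulr1 in vg; rewrite E2 eG scale1r mulr1 in vG.
have vx : v x = - (v g * u x).
  rewrite -[LHS]mul1r vg -mulrA; apply/eqP; rewrite -addr_eq0 -mulrDr addrC.
  by rewrite -ux mulr0.
have vX : v X = - (v G * u X).
  rewrite -[LHS]mul1r vG -mulrA; apply/eqP; rewrite -addr_eq0 -mulrDr addrC.
  by rewrite -uX mulr0.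
exists (v g), (v G); split=> //; split=> c; rewrite actE;
  have [_ sg sG sx sX] := sweedler_gen c ul vl.
- by rewrite sg.
- by rewrite sG.
- by rewrite sx vx -u11 mulr1 mulrN !mulrA.
by rewrite sX vX -u11 mulr1 mulrN !mulrA.
Qed.

(** Convolving u with an invertible scalar functional leaves the action unchanged: scalars are
    central, so the functional meets its inverse across c. *)
Lemma rescale_inner act u (s t : F) : s != 0 -> t != 0 -> inner_via act u ->
  exists2 u', inner_via act u' &
    [/\ u' g = s *: u g, u' G = t *: u G, u' x = u x & u' X = u X].
Proof.
move=> s0 t0 [ul u1 [v [vl uv actE]]].
(* u' is the convolution product u * chi, and v' = chi^-1 * v, where the       *)
(* functional chi is supported on the group-likes g^a G^b.                    *)
pose chi (a b : bool) : F := (if a then s else 1) * (if b then t else 1).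
have chi0 a b : chi a b != 0 by case: a; case: b; rewrite mulf_neq0 ?oner_neq0.
pose fu (p : monom) : R := let: (a, b, c, d) := p in chi a b *: u (mon p).
pose fv (p : monom) : R :=
  let: (a, b, c, d) := p in (chi (a (+) c) (b (+) d))^-1 *: v (mon p).
have xorK a i k : a (+) k (+) (i (+) k) = a (+) i by case: a; case: i; case: k.
pose ext f h : R := \sum_(p : monom) coord h p *: f p.
have extl f : linear (ext f).
  move=> c h k; rewrite /ext scaler_sumr -big_split; apply: eq_bigr => p _ /=.
  by rewrite !fmod_coordE scalerDl scalerA.
have extE f p : ext f (mon p) = f p by apply: (fbase_sum f).
have sumE c h : sweedler (fun h1 h2 => ext fu h1 * c * ext fv h2) h =
    sweedler (fun h1 h2 => u h1 * c * v h2) h.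
  move: h; apply: linear_eq_mon; [exact: sweedler_linear.. |].
  move=> [[[a b] i] j]; rewrite !sweedler_mon //.
  apply: eq_bigr => k _; apply: eq_bigr => l _; congr (_ *: _).
  by rewrite !extE /= -!scalerAl -scalerAr scalerA mulfV ?scale1r.
exists (ext fu); last first.
  by split; rewrite extE /= /chi /= ?mulr1 ?mul1r ?scale1r.
split=> //; first by rewrite extE /= /chi mulr1 scale1r -u1.
exists (ext fv); split=> // => [h|h c]; last by rewrite sumE.
split.
  rewrite -(uv h).1.
  transitivity (sweedler (fun h1 h2 => ext fu h1 * 1 * ext fv h2) h).
    by apply: eq_sweedler => p q; rewrite mulr1.
  by rewrite sumE; apply: eq_sweedler => p q; rewrite mulr1.
transitivity (sweedler (fun h1 h2 => ext fv h1 * 1 * ext fu h2) h).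
  by apply: eq_sweedler => p q; rewrite mulr1.
have cl : linear (fun h => (counit h)%:A : R).
  have [eL _] := counit_morphism F.
  by move=> c k l; rewrite eL scalerDl scalerA.
move: h; apply: linear_eq_mon; [exact: sweedler_linear | exact: cl |].
move=> [[[a b] i] j]; rewrite sweedler_mon //.
(* In this order the scalars do not cancel termwise, but their product is the same in all terms. It
   is 1 if i and j are false; otherwise the counit of the monomial is 0. *)
transitivity ((chi (a (+) i) (b (+) j))^-1 * chi a b *:
    sweedler (fun h1 h2 => v h1 * 1 * u h2) (mon (a, b, i, j))).
  rewrite sweedler_mon // scaler_sumr; apply: eq_bigr => k _.
  rewrite scaler_sumr; apply: eq_bigr => l _; rewrite !extE /=.
  rewrite -!scalerAl -scalerAr !scalerA.
  by rewrite !xorK -mulrA mulrC.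
transitivity ((chi (a (+) i) (b (+) j))^-1 * chi a b *:
  ((counit (mon (a, b, i, j)))%:A : R)).
  by congr (_ *: _); rewrite -(uv _).2; apply: eq_sweedler => p q; rewrite mulr1.
have [_ [_ eM]] := counit_morphism F; have [eg eG ex eX] := counit_gen F.
case: i; case: j; rewrite monE !eM ?expr1 ?ex ?eX ?(mulr0, mul0r) ?scale0r
  ?scaler0 //.
by rewrite !addbF mulVf // scale1r.
Qed.

Section Transport.
Variables (phi psi : R -> R).
Hypotheses (phil : linear phi) (phiM : monoid_morphism phi).
Hypotheses (phiK : cancel phi psi) (psiK : cancel psi phi).

Let psil : linear psi.
Proof. by move=> s y z; apply: (can_inj phiK); rewrite phil !psiK. Qed.
Let psi1 : psi 1 = 1.
Proof. by rewrite -[in LHS]phiM.1 phiK. Qed.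
Let psiM : {morph psi : y z / y * z}.
Proof. by move=> y z; apply: (can_inj phiK); rewrite phiM.2 !psiK. Qed.

Let phiA (s : F) : phi s%:A = s%:A.
Proof.
have := phil s 1 0; rewrite addr0 phiM.1 => ->.
by rewrite (lin0 phil) addr0.
Qed.

Lemma morph_sweedler (f f' : DT2 F -> DT2 F -> R) h :
  (forall p q, phi (f p q) = f' p q) -> phi (sweedler f h) = sweedler f' h.
Proof.
move=> ff; pose fL := GRing.isLinear.Build F R R *:%R phi phil.
pose ff' : {linear R -> R} := HB.pack phi fL.
rewrite [LHS](linear_sum ff'); apply: eq_bigr => p _.
by rewrite linearZ /= ff.
Qed.

Lemma transport_action act :
  is_action act -> is_action (fun h c => phi (act h (psi c))).
Proof.
move=> [a1 a2 [a3 a4] a5 a6]; split.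
- by move=> h s c c'; rewrite psil a1 phil.
- by move=> c s h h'; rewrite a2 phil.
- by split=> [c|h k c]; [rewrite a3 psiK | rewrite a4 phiK].
- by move=> h; rewrite psi1 a5 phiA.
move=> h c c'; rewrite psiM a6; apply: morph_sweedler => p q.
by rewrite phiM.2.
Qed.

Lemma transport_inner act u :
  inner_via act u -> inner_via (fun h c => phi (act h (psi c))) (phi \o u).
Proof.
move=> [ul u1 [v [vl uv actE]]]; split=> [s h k||/=].
- by rewrite /= ul phil.
- by rewrite /= u1 phiM.1.
exists (phi \o v); split=> [s h k|h|h c].
- by rewrite /= vl phil.
- have [e1 e2] := uv h; rewrite -phiA -{1}e1 -e2.
  by split; symmetry; apply: morph_sweedler => p q; rewrite phiM.2.
rewrite actE; apply: morph_sweedler => p q.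
by rewrite !phiM.2 psiK.
Qed.

End Transport.

Lemma action_gen_ext act act' : is_action act -> is_action act' ->
  (forall c, act g c = act' g c) -> (forall c, act G c = act' G c) ->
  (forall c, act x c = act' x c) -> (forall c, act X c = act' X c) ->
  forall h c, act h c = act' h c.
Proof.
move=> [_ a2 [a3 a4] _ _] [_ b2 [b3 b4] _ _] eg eG ex eX h c.
move: h; apply: linear_eq_mon => // -[[[i j] k] l]; rewrite monE.
have E (y : DT2 F) (n : bool) d : (forall c, act y c = act' y c) ->
    act (y ^+ n) d = act' (y ^+ n) d.
  by move=> ey; case: n; rewrite ?expr1 ?expr0 ?a3 ?b3.
by rewrite !(a4, b4) !E.
Qed.

End Algebras.

(** * From an inner action on matrices to a quadruple *)

Section Matrices.
Variable n : nat.
Local Notation M := 'M[F]_n.+1.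

Lemma central_scalar (z : M) : (forall c, z * c = c * z) -> exists s, z = s%:M.
Proof.
move=> zc; exists (z 0 0); apply/matrixP => i j.
have /matrixP/(_ i 0) := zc (delta_mx j 0).
rewrite !mxE (bigD1 j) //= big1 => [|k kj]; last first.
  by rewrite mxE (negbTE kj) mulr0.
rewrite mxE !eqxx mulr1 addr0 => ->.
rewrite (bigD1 0) //= big1 => [|k k0]; last first.
  by rewrite mxE (negbTE k0) andbF mul0r.
by rewrite mxE eqxx andbT addr0 mulr_natl.
Qed.

Lemma conj_square (a w : M) : a * w = 1 -> w * a = 1 ->
  (forall c, a * (a * c * w) * w = c) -> exists2 s, s != 0 & a * a = s%:M.
Proof.
move=> aw wa aac; have [c|s aas] := @central_scalar (a * a).
  rewrite -[in RHS](aac c) !mulrA -[_ * w * a]mulrA wa mulr1.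
  by rewrite -[_ * w * a]mulrA wa mulr1.
exists s => //; apply/eqP => s0; have := aw.
have -> : a = a * a * w by rewrite -mulrA aw mulr1.
rewrite aas s0 -scalemx1 scale0r !mul0r => /eqP.
by rewrite eq_sym oner_eq0.
Qed.

(** Equal conjugations make b a scalar multiple of a. The difference d = x1 - x2 satisfies dc = a c
    w d, so wd is central and d = ta; but d anticommutes with a, hence 2t a^2 = 0 and t = 0. *)
Lemma skew_inner_inj (nz2 : 2%:R != 0 :> F) (a w b v x1 x2 : M) :
  a * w = 1 -> w * a = 1 -> b * v = 1 -> v * b = 1 ->
  a * x1 = - (x1 * a) -> b * x2 = - (x2 * b) ->
  (forall c, a * c * w = b * c * v) ->
  (forall c, x1 * c - a * c * w * x1 = x2 * c - b * c * v * x2) ->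
  x1 = x2.
Proof.
move=> aw wa bv vb ax bx ab xx.
have [c|s wb] := @central_scalar (w * b).
  have := ab c => /(congr1 (fun y => w * y * b)).
  by rewrite !mulrA wa mul1r -!mulrA vb mulr1.
have bE : b = s *: a.
  by rewrite -[b]mul1r -aw -mulrA wb -mulmxE mul_mx_scalar.
have s0 : s != 0.
  apply/eqP => s0; have := bv; rewrite bE s0 scale0r mul0r => /eqP.
  by rewrite eq_sym oner_eq0.
have ax2 : a * x2 = - (x2 * a).
  by apply: (scalerI s0); rewrite scalerAl -bE bx bE scalerN scalerAr.
have [c|t wd] := @central_scalar (w * (x1 - x2)).
  have : (x1 - x2) * c = a * c * w * (x1 - x2).
    have := xx c; rewrite -ab mulrBl mulrBr => /eqP; rewrite subr_eq => /eqP ->.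
    by rewrite addrAC [X in X - _]addrC addrK addrC.
  by move/(congr1 (fun y => w * y)); rewrite !mulrA wa mul1r => ->; rewrite ?mulrA.
have dE : x1 - x2 = t *: a.
  by rewrite -[LHS]mul1r -aw -mulrA wd -mulmxE mul_mx_scalar.
have : a * (x1 - x2) = - ((x1 - x2) * a).
  by rewrite mulrBr mulrBl ax ax2 opprB opprK addrC.
rewrite dE -scalerAr -scalerAl => /eqP; rewrite -addr_eq0 -mulr2n -scaler_nat scaler_eq0.
rewrite (negbTE nz2) scaler_eq0 /= => /orP[/eqP t0|/eqP aa0].
  by apply/eqP; rewrite -subr_eq0 dE t0 scale0r.
have := aw; have -> : a = a * a * w by rewrite -mulrA aw mulr1.
by rewrite aa0 !mul0r => /eqP; rewrite eq_sym oner_eq0.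
Qed.

(** Composites of skew inner derivations: when x and X anticommute with a and b, the mixed terms
    cancel. The identities turn x^2 = 0, X^2 = 0 and xX + Xx = 1 - gG into centrality statements. *)
Lemma comp_skew (a b x X c : M) (ad bd : M -> M) :
  a * a = 1 -> b * b = 1 -> a * b = - (b * a) ->
  a * x = - (x * a) -> b * x = - (x * b) -> a * X = - (X * a) ->
  b * X = - (X * b) ->
  (forall c, ad c = x * c - a * c * a * x) ->
  (forall c, bd c = X * c - b * c * b * X) ->
  [/\ ad (ad c) = x * x * c - c * (x * x), bd (bd c) = X * X * c - c * (X * X) &
      ad (bd c) + bd (ad c) =
        (x * X + X * x) * c - a * b * c * (b * a) * (x * X + X * x)].
Proof.
move=> aa bb ab ax bx aX bX adE bdE.
have anti (y z Z : M) : y * z = - (z * y) -> y * (z * Z) = - (z * (y * Z)).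
  by move=> yz; rewrite !mulrA yz mulNr.
have axZ Z := anti _ _ Z ax; have bxZ Z := anti _ _ Z bx.
have aXZ Z := anti _ _ Z aX; have bXZ Z := anti _ _ Z bX.
have abZ Z := anti _ _ Z ab.
have aaZ Z : a * (a * Z) = Z by rewrite mulrA aa mul1r.
have bbZ Z : b * (b * Z) = Z by rewrite mulrA bb mul1r.
split; rewrite !(adE, bdE).
all: do 5 rewrite ?(mulrDl, mulrDr, mulNr, mulrN, opprK) -?mulrA ?ax ?bx ?aX ?bX ?ab
       ?axZ ?bxZ ?aXZ ?bXZ ?aaZ ?bbZ ?aa ?bb ?abZ ?mulr1.
all: by apply/matrixP => i j; rewrite !mx_linE; ring.
Qed.

Lemma inner_quad_rel (nz2 : 2%:R != 0 :> F) (act : DT2 F -> M -> M) u :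
  is_action act -> inner_via act u -> anticommuting u ->
  u g * u g = 1 -> u G * u G = 1 -> u g * u G <> u G * u g ->
  (exists i : nat, u x ^+ i = 0) ->
  exists tau, quad_rel tau (u g) (u G) (u x) (u X).
Proof.
move=> [_ a2 [a3 a4] _ _] uin [gx Gx gX GX] gg GG gG [i xi].
have [w [W [[gw wg] [Gw wG] [actg actG actx actX]]]] := inner_gen uin.
have ww : w = u g by rewrite -[w]mulr1 -gg mulrA wg mul1r.
have WW : W = u G by rewrite -[W]mulr1 -GG mulrA wG mul1r.
rewrite {w gw wg}ww in actg actx; rewrite {W Gw wG}WW in actG actX.
have [[rgg rGG rxx rXX] [rgG _ _] _ rxX] := DT2_relationsP F.
move: (u g) (u G) (u x) (u X) => a b y Y in gx Gx gX GX gg GG gG xi actg actG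
  actx actX *.
have aaZ Z : a * (a * Z) = Z by rewrite mulrA gg mul1r.
have bbZ Z : b * (b * Z) = Z by rewrite mulrA GG mul1r.
have b0 : b != 0.
  by apply/eqP => b0; have := GG; rewrite b0 mul0r => /eqP; rewrite eq_sym oner_eq0.
have ab : a * b = - (b * a).
  (* As gG = Gg, conjugation by ab equals conjugation by ba, so abab is a scalar s. Then ab = s ba
     with s^2 = 1, and s = 1 is excluded by noncommutativity. *)
  have [c|s abab] := @central_scalar (a * (b * (a * b))).
    have := congr1 (act^~ c) rgG; rewrite /= !a4 !(actg, actG).
    move/(congr1 (fun z => a * b * z * (a * b))).
    by rewrite -!mulrA !aaZ !bbZ aaZ GG mulr1.
  have abE : a * b = s *: (b * a).
    have := congr1 (fun z => z * (b * a)) abab.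
    by rewrite -!mulrA bbZ gg mulr1 -mulmxE mul_scalar_mx.
  have ss : s ^+ 2 = 1.
    rewrite -scalemx1 in abab.
    have baba : b * (a * (b * a)) = s *: 1.
      have := congr1 (fun z => b * z * b) abab.
      by rewrite -!mulrA -scalerAl mul1r -scalerAr GG mulr1.
    have := congr1 (fun z => z * (s *: 1)) abab.
    rewrite -{1}baba -!mulrA !(aaZ, bbZ) gg -scalerAr mulr1 scalerA -expr2.
    move=> /eqP; rewrite -subr_eq0 -{1}[1 : M]scale1r -scalerBl scaler_eq0 oner_eq0 orbF.
    by rewrite subr_eq0 => /eqP.
  move/eqP: ss; rewrite sqrf_eq1 => /orP[] /eqP s1; rewrite s1 in abE.
    by case: gG; rewrite abE scale1r.
  by rewrite abE scaleN1r.
have ad0 h c : h = 0 -> act h c = 0 by move=> ->; exact: lin0 (a2 c).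
have skew c := comp_skew c gg GG ab gx Gx gX GX actx actX.
have [c|s yys] := @central_scalar (y * y).
  have [yyE _ _] := skew c; apply/eqP; rewrite -subr_eq0 -yyE -a4.
  by rewrite ad0.
have [c|tau YY] := @central_scalar (Y * Y).
  have [_ YYE _] := skew c; apply/eqP; rewrite -subr_eq0 -YYE -a4.
  by rewrite ad0.
have yy0 : y * y = 0.
  have : (y * y) ^+ i = 0 by rewrite -expr2 -exprM mulnC exprM xi expr0n.
  rewrite yys -scalemx1 exprZn expr1n => /eqP.
  rewrite scaler_eq0 oner_eq0 orbF expf_eq0 => /andP[_ /eqP ->].
  by rewrite scale0r.
(* With D = yY + Yy - 1, the last relation says Dc = (ab) c (ba) D, so (ba) D is central and D = m
   ab. *)
have [c|m mE] := @central_scalar (b * a * (y * Y + Y * y - 1)).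
  have [_ _] := skew c; rewrite -!a4.
  have -> : act (x * X) c + act (X * x) c = c - a * b * c * (b * a).
    have aD h k : act (h + k) c = act h c + act k c.
      by have := a2 c 1 h k; rewrite !scale1r.
    have aN h : act (- h) c = - act h c.
      by apply: (addrI (act h c)); rewrite -aD !subrr ad0.
    by rewrite -aD rxX aD aN a3 a4 actG actg !mulrA.
  move=> /eqP; rewrite eq_sym subr_eq => /eqP E.
  have {}E : (y * Y + Y * y - 1) * c = a * b * c * (b * a) * (y * Y + Y * y - 1).
    by rewrite mulrBl mul1r E mulrBr mulr1 addrAC [X in X - _]addrC addrK addrC.
  by rewrite -[LHS]mulrA E -!mulrA !(aaZ, bbZ).
have DE : y * Y + Y * y - 1 = m *: (a * b).
  have := congr1 (fun z => a * b * z) mE; rewrite -!mulrA !(aaZ, bbZ) => ->.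
  by rewrite mulrA -mulmxE mul_mx_scalar.
have comD : a * (y * Y + Y * y - 1) = (y * Y + Y * y - 1) * a.
  rewrite !(mulrDl, mulrDr) !mulrA gx gX !mulNr -!mulrA gx gX !mulrN !opprK.
  by rewrite mulr1 mul1r.
(* D commutes with a, whereas ab anticommutes with it. *)
have m0 : m = 0.
  move: comD; rewrite DE -scalerAr -scalerAl aaZ ab mulNr -mulrA gg mulr1 scalerN.
  move=> /eqP; rewrite -addr_eq0 -mulr2n -scaler_nat !scaler_eq0.
  by rewrite (negbTE nz2) (negbTE b0) orbF /= => /eqP.
exists tau; do 2?split=> //.
apply/eqP; rewrite -subr_eq0; apply/eqP.
by rewrite -[LHS]/(y * Y + Y * y - 1) DE m0 scale0r.
Qed.

End Matrices.
End InnerActions.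

(** * Uniqueness and conclusion *)

Lemma cast_std_rel (F : fieldType) (nz2 : 2%:R != 0 :> F) r m
    (e : ((r + r) * 2)%N = m) (tau : F) :
  quad_rel tau (castmx (e, e) (std_g F r)) (castmx (e, e) (std_G F r))
    (castmx (e, e) (std_x F r)) (castmx (e, e) (std_X r tau)).
Proof. by case: m / e; rewrite !castmx_id; apply: std_rel. Qed.

Lemma standard_uniq (F : fieldType) n r (e : ((r + r) * 2)%N = n.+1) (tau : F)
    (act act' : DT2 F -> 'M[F]_n.+1 -> 'M[F]_n.+1) :
  is_standard e tau act -> is_standard e tau act' -> forall h c, act h c = act' h c.
Proof.
move=> [a1 [u uin [ug uG ux uX]]] [a2 [v vin [vg vG vx vX]]].
have [w [W [[gw wg] [Gw wG] [actg actG actx actX]]]] := inner_gen uin.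
have [z [Z [[gz zg] [Gz zG] [actg' actG' actx' actX']]]] := inner_gen vin.
have wz : w = z by rewrite -[w]mulr1 -gz vg -ug mulrA wg mul1r.
have WZ : W = Z by rewrite -[W]mulr1 -Gz vG -uG mulrA wG mul1r.
apply: action_gen_ext => // c;
  rewrite ?(actg, actG, actx, actX, actg', actG', actx', actX');
  by rewrite ?wz ?WZ ?ug ?uG ?ux ?uX ?vg ?vG ?vx ?vX.
Qed.

Lemma inner_via_ext (F : fieldType) (R : algType F) (act act' : DT2 F -> R -> R) u :
  (forall h c, act h c = act' h c) -> inner_via act u -> inner_via act' u.
Proof.
move=> aa [ul u1 [v [vl uv actE]]]; split=> //; exists v; split=> // h c.
by rewrite -aa.
Qed.

(** The isomorphism phi carries u to a second map implementing act', so phi(u(X)) = v(X) by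
    [skew_inner_inj]. Squaring compares the two parameters, since phi fixes scalars. *)
Lemma standard_tau (F : fieldType) (nz2 : 2%:R != 0 :> F) n r
    (e : ((r + r) * 2)%N = n.+1) (tau tau' : F)
    (act act' : DT2 F -> 'M[F]_n.+1 -> 'M[F]_n.+1) u :
  inner_via act u -> u (GD F) * u (XD F) = - (u (XD F) * u (GD F)) ->
  u (XD F) * u (XD F) = tau%:M -> is_standard e tau' act' ->
  action_iso act act' -> tau' = tau.
Proof.
move=> uin GX XX [_ [v vin [_ vG _ vX]]] [phi [phil phiM [psi phiK psiK]] iso].
have uin' : inner_via act' (phi \o u).
  have := transport_inner phil phiM psiK uin.
  by apply: inner_via_ext => h c; rewrite -iso psiK.
have [w [W [_ [Gw wG] [_ actG _ actX]]]] := inner_gen vin.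
have [z [Z [_ [Gz zG] [_ actG' _ actX']]]] := inner_gen uin'.
have [_ _ [_ cGX] _] := cast_std_rel nz2 e tau'.
have [[_ _ _ cXX] _ _ _] := cast_std_rel nz2 e tau'.
have phiN y : phi (- y) = - phi y.
  by have := phil (-1) y 0; rewrite (lin0 phil) !addr0 !scaleN1r.
have vu : v (XD F) = phi (u (XD F)).
  apply: (skew_inner_inj nz2 Gw wG Gz zG); first by rewrite vG vX.
  - by rewrite /= -!phiM.2 GX phiN.
  - by move=> c; rewrite -actG actG'.
  by move=> c; rewrite -actX actX'.
have : tau'%:M = phi tau%:M.
  by rewrite -XX phiM.2 -vu vX -cXX.
have -> : phi tau%:M = tau%:M.
  rewrite -scalemx1; have := phil tau 1 0; rewrite (lin0 phil) !addr0 => ->.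
  by rewrite phiM.1.
by move/matrixP/(_ 0 0); rewrite !mxE eqxx.
Qed.

Lemma inv_sqrt (F : closedFieldType) (a : F) : a != 0 ->
  exists2 s : F, s != 0 & s * s * a = 1.
Proof.
move=> a0; have [s] := @solve_monicpoly F 2 (fun i => if i == 0 then a^-1 else 0) isT.
rewrite !big_ord_recl big_ord0 /= mulr1 mul0r !addr0 expr2 => sE.
exists s; last by rewrite sE mulVf.
by apply/eqP => s0; move/eqP: sE; rewrite s0 mul0r eq_sym invr_eq0 (negbTE a0).
Qed.

Theorem proposition7p3 (F : closedFieldType) (char_F : 2%N \notin [pchar F])
    (n : nat) (act : DT2 F -> 'M[F]_n.+1 -> 'M[F]_n.+1)
    (u : DT2 F -> 'M[F]_n.+1)
    (act_action : is_action act) (act_inner : inner_via act u)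
    (u_anti : anticommuting u)
    (ug_uG : u (gD F) * u (GD F) <> u (GD F) * u (gD F))
    (ux_nilp : exists i : nat, u (xD F) ^+ i = 0) :
  exists (r : nat) (e : ((r + r) * 2)%N = n.+1)
         (tau : F) (act' : DT2 F -> 'M[F]_n.+1 -> 'M[F]_n.+1),
    [/\ is_standard e tau act', action_iso act act' &
      forall (tau' : F) (act'' : DT2 F -> 'M[F]_n.+1 -> 'M[F]_n.+1),
        is_standard e tau' act'' -> action_iso act act'' ->
        tau' = tau /\ forall h a, act'' h a = act' h a].
Proof.
have nz2 : 2%:R != 0 :> F by move: char_F; rewrite inE.
have [_ _ [act1 actM] _ _] := act_action.
have [[rgg rGG _ _] _ _ _] := DT2_relationsP F.
have [w [W [[gw wg] [Gw wG] [actg actG _ _]]]] := inner_gen act_inner.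
have [c|al al0 gg] := conj_square gw wg; first by rewrite -!actg -actM rgg act1.
have [c|be be0 GG] := conj_square Gw wG; first by rewrite -!actG -actM rGG act1.
(* Algebraic closure enters here, to scale u(g) and u(G) to involutions. *)
have [s s0 ss] := inv_sqrt al0; have [t t0 tt] := inv_sqrt be0.
have [u' u'_inner [u'g u'G u'x u'X]] := rescale_inner s0 t0 act_inner.
have [gx Gx gX GX] := u_anti.
have [|||||tau rel] := inner_quad_rel nz2 act_action u'_inner.
- by split; rewrite ?u'g ?u'G ?u'x ?u'X -!scalerAl -!scalerAr -scalerN ?(gx, Gx, gX, GX).
- by rewrite u'g -scalerAl -scalerAr scalerA gg -scalemx1 scalerA ss scale1r.
- by rewrite u'G -scalerAl -scalerAr scalerA GG -scalemx1 scalerA tt scale1r.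
- rewrite u'g u'G -!scalerAl -!scalerAr !scalerA [t * s]mulrC => eq_st.
  exact/ug_uG/(scalerI (mulf_neq0 s0 t0)).
- by rewrite u'x.
have [r [e [P [Q [PQ QP [gP GP xP XP]]]]]] := quad_std nz2 rel.
(* Conjugation by P carries the values of u' to the standard matrices. *)
pose phi c := Q * c * P; pose psi c := P * c * Q.
have phil : linear phi by move=> k y z; rewrite /phi mulrDr mulrDl -scalerAr -scalerAl.
have phiM : monoid_morphism phi.
  by split=> [|y z]; rewrite /phi ?mulr1 // !mulrA -[_ * P * Q]mulrA [P * Q]PQ mulr1.
have phiK : cancel phi psi.
  by move=> c; rewrite /psi /phi !mulrA [P * Q]PQ mul1r -mulrA [P * Q]PQ mulr1.
have psiK : cancel psi phi.
  by move=> c; rewrite /psi /phi !mulrA [Q * P]QP mul1r -mulrA [Q * P]QP mulr1.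
have phiE y z : y *m P = P *m z -> phi y = z.
  by move=> yz; rewrite /phi -mulrA [y * P]yz mulrA [Q * P]QP mul1r.
pose act' h c := phi (act h (psi c)).
have std' : is_standard e tau act'.
  split; first exact: transport_action.
  exists (phi \o u'); first exact: transport_inner.
  by split; apply: phiE.
exists r, e, tau, act'; split=> //.
  by exists phi; [split=> //; exists psi | move=> h c; rewrite /act' phiK].
move=> tau' act'' std'' iso; have [[_ _ _ XX] _ [_ GX'] _] := rel.
have tauE := standard_tau nz2 u'_inner GX' XX std'' iso.
by split=> //; apply: standard_uniq std'; rewrite -tauE.
Qed.
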